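(* There exists a universal constant $c>0$ such that for all integers $n\ge1$ and $1\le t\le n$ there exists a nonempty $t$-wise permutation $T\subset S_n$ satisfying $|T|\le(cn)^{ct}$.
   Context: $S_n$ is the symmetric group on $\{1,\ldots,n\}$. A family of permutations $T\subset S_n$ is called a $t$-wise permutation if for any distinct elements $i_1,\ldots,i_t\in\{1,\ldots,n\}$ and any distinct elements $j_1,\ldots,j_t\in\{1,\ldots,n\}$, $$\left|\{\pi\in T:\ \pi(i_1)=j_1,\ldots,\pi(i_t)=j_t\}\right|=\frac{1}{n(n-1)\cdots(n-t+1)}|T|.$$ A universal constant is one independent of all other parameters. *)

(* Defs.v *)
From HB Require Import structures.
From mathcomp Require Import all_boot all_order all_algebra all_fingroup.

Set Implicit Arguments.
Unset Strict Implicit.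
Unset Printing Implicit Defensive.

Import GRing.Theory Num.Theory.

Local Open Scope ring_scope.

(* The distinct points i_1, ..., i_t (resp. j_1, ..., j_t) are the values of an
   injective map from 'I_t; n ^_ t is n (n - 1) ... (n - t + 1). *)
Definition twise_permutation (n t : nat) (T : {set 'S_n}) : Prop :=
  forall i j : 'I_t -> 'I_n, injective i -> injective j ->
    #|[set p in T | [forall k : 'I_t, p (i k) == j k]]|%:R
      = 1 / (n ^_ t)%:R * #|T|%:R :> rat.

(* Main.v *)
Require Import Defs.
From HB Require Import structures.
From mathcomp Require Import all_boot all_order all_algebra all_fingroup.
From mathcomp Require Import reals exp.
From mathcomp Require Import zify ring lra.

Set Implicit Arguments.
Unset Strict Implicit.
Unset Printing Implicit Defensive.

Import Order.TTheory GRing.Theory Num.Theory.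

Local Open Scope ring_scope.

(** Identify a set T of permutations with its indicator function. For a partial
    matching m, a set of pairs (i, j), let [stat m w] be the sum of w over the
    permutations that send i to j for all (i, j) in m, and call w null of order
    k if [stat m w] vanishes for all m with at most k pairs. Then T is t-wise
    uniform as soon as its indicator differs from a constant function by a null
    function of order t. The theorem is about solving this linear system with a
    0/1 function of small support, and everything happens modulo null functions.

    The basic null functions are cubes, the translates of a product of factors
    1 - tau over disjoint transpositions tau: a cube with more than k factors is
    null of order k, because k pairs cannot meet all these transpositions
    [cube_null]. Conversely every null function of order 2t is a rational
    combination of cubes with t + 1 factors [null_span_cubes].

    Two permutations that agree on the transposed points of a cube are joined by
    at most n transpositions that avoid these points, so rebasing the cube from
    one to the other costs at most n cubes with one more factor. After t + 1
    rounds nothing remains modulo null functions of order t. Hence a permutation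
    equals, modulo null functions and with n^O(t) terms, a combination of cubes
    based at permutations that can be chosen at will, up to prescribed values at
    O(t) points [Rep_delta]. Choosing fresh bases each time gives
    1_P - 1_Q with P and Q disjoint from any given small set [fresh_delta];
    choosing canonical ones gives an integer combination of a fixed set of
    n^O(t) permutations, the generators [decode].

    For n > 1000 t the set T is built as follows (otherwise T = S_n will do).
    Reserve for each generator many disjoint pairs P, Q as above: switching
    between P and Q adds or removes that generator, so the reserved region R
    holds, for each bounded integer combination E of generators, a set congruent
    to g + E with g fixed [toggle_generators]. The function g is completed to
    the uniform weight X / n! by a function eta with values in [0, 1] outside R,
    which exists because each point mass can be spread thinly [near_uniform].
    Moving eta to a vertex of the polytope of all functions with the same
    statistics makes it the indicator of a set F up to an error c whose mass is
    at most the number of statistics, thus n^O(t) whatever X is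
    [round_to_set]. So g + 1_F + c is congruent to X / n!.

    It remains to cancel c exactly. There is an integer-valued D0 congruent to
    X / n! [signed_design], so D = D0 - g - 1_F is integer-valued and congruent
    to c modulo null functions of order 2t, that is, modulo cubes. Written in
    the generators, cubes are short integer vectors; rounding their coefficients
    in D - c turns c into a congruent integer combination E of generators with
    coefficients n^O(t) [integral_correction]. This bound does not involve the
    number of toggles, so enough of them can be reserved beforehand, and
    toggling by E inside R yields T. *)

(** * Statistics and null functions *)

Definition contains n (m : {set 'I_n * 'I_n}) (x : 'S_n) :=
  [forall p in m, x p.1 == p.2].

Definition stat n (m : {set 'I_n * 'I_n}) (w : 'S_n -> rat) : rat :=
  \sum_(x | contains m x) w x.

Definition null n k (w : 'S_n -> rat) :=
  forall m : {set 'I_n * 'I_n}, (#|m| <= k)%N -> stat m w = 0.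

Lemma containsP n (m : {set 'I_n * 'I_n}) (x : 'S_n) :
  reflect (forall i j, (i, j) \in m -> x i = j) (contains m x).
Proof.
apply: (iffP forall_inP) => [h i j /h /eqP //|h [i j] /h /= -> //].
Qed.

Lemma statE n (m : {set 'I_n * 'I_n}) w :
  stat m w = \sum_x (contains m x)%:R * w x.
Proof.
rewrite /stat big_mkcond; apply: eq_bigr => x _.
by case: (contains m x); rewrite ?mul1r ?mul0r.
Qed.

Lemma eq_stat n (m : {set 'I_n * 'I_n}) u v : u =1 v -> stat m u = stat m v.
Proof. by move=> e; apply: eq_bigr => x _. Qed.

Lemma statD n (m : {set 'I_n * 'I_n}) u v :
  stat m (fun x => u x + v x) = stat m u + stat m v.
Proof. by rewrite /stat big_split. Qed.

Lemma statB n (m : {set 'I_n * 'I_n}) u v :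
  stat m (fun x => u x - v x) = stat m u - stat m v.
Proof. by rewrite /stat sumrB. Qed.

Lemma statZ n (m : {set 'I_n * 'I_n}) a u :
  stat m (fun x => a * u x) = a * stat m u.
Proof. by rewrite /stat mulr_sumr. Qed.

Lemma stat_sum n (m : {set 'I_n * 'I_n}) (I : Type) (r : seq I) (P : pred I)
    (F : I -> 'S_n -> rat) :
  stat m (fun x => \sum_(i <- r | P i) F i x) = \sum_(i <- r | P i) stat m (F i).
Proof. by rewrite /stat exchange_big. Qed.

Lemma eq_null n k (u v : 'S_n -> rat) : u =1 v -> null k u -> null k v.
Proof. by move=> e h m /h <-; apply: eq_stat => x; rewrite e. Qed.

Lemma null0 n k : null k (fun _ : 'S_n => 0).
Proof. by move=> m _; apply: big1. Qed.

Lemma nullD n k (u v : 'S_n -> rat) :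
  null k u -> null k v -> null k (fun x => u x + v x).
Proof. by move=> hu hv m hm; rewrite statD hu // hv // addr0. Qed.

Lemma nullB n k (u v : 'S_n -> rat) :
  null k u -> null k v -> null k (fun x => u x - v x).
Proof. by move=> hu hv m hm; rewrite statB hu // hv // subr0. Qed.

Lemma nullZ n k a (u : 'S_n -> rat) : null k u -> null k (fun x => a * u x).
Proof. by move=> hu m hm; rewrite statZ hu // mulr0. Qed.

Lemma null_sum n k (I : Type) (r : seq I) (P : pred I) (F : I -> 'S_n -> rat) :
  (forall i, P i -> null k (F i)) ->
  null k (fun x => \sum_(i <- r | P i) F i x).
Proof. by move=> h m hm; rewrite stat_sum big1 // => i /h ->. Qed.

Lemma nullW n j k (u : 'S_n -> rat) : (j <= k)%N -> null k u -> null j u.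
Proof. by move=> le h m hm; apply: h; apply: leq_trans le. Qed.

(** * Cubes *)

Definition delta n (x : 'S_n) : {ffun 'S_n -> rat} := [ffun y => (y == x)%:R].

(** [diff f l x] is the value at f of the product of the factors 1 - tau over the
    transpositions tau of l, based at x. [cube] is the element of the group
    algebra that represents this functional, see [sum_cube]. *)
Fixpoint diff n (V : zmodType) (f : 'S_n -> V) (l : seq ('I_n * 'I_n)) (x : 'S_n)
    : V :=
  if l is p :: l' then diff f l' x - diff f l' (tperm p.1 p.2 * x)%g else f x.

Lemma diff_cons n (V : zmodType) (f : 'S_n -> V) p l x :
  diff f (p :: l) x = diff f l x - diff f l (tperm p.1 p.2 * x)%g.
Proof. by []. Qed.

Definition cube n (l : seq ('I_n * 'I_n)) (x : 'S_n) := diff (@delta n) l x.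

Fixpoint ends n (l : seq ('I_n * 'I_n)) : seq 'I_n :=
  if l is p :: l' then [:: p.1, p.2 & ends l'] else [::].

Lemma size_ends n (l : seq ('I_n * 'I_n)) : size (ends l) = (size l).*2.
Proof. by elim: l => //= p l ->. Qed.

Lemma sum_delta n (x : 'S_n) (f : 'S_n -> rat) :
  \sum_y delta x y * f y = f x.
Proof.
rewrite (bigD1 x) //= ffunE eqxx mul1r big1 ?addr0 // => y /negbTE ne.
by rewrite ffunE ne mul0r.
Qed.

Lemma sum_cube n l (x : 'S_n) (f : 'S_n -> rat) :
  \sum_y cube l x y * f y = diff f l x.
Proof.
elim: l x => [|p l IH] x /=; first exact: sum_delta.
rewrite /cube /= -!IH -sumrB; apply: eq_bigr => y _.
by rewrite !ffunE mulrBl.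
Qed.

Lemma stat_cube n m l (x : 'S_n) :
  stat m (cube l x) = diff (fun y => (contains m y)%:R) l x.
Proof.
by rewrite statE -sum_cube; apply: eq_bigr => y _; rewrite mulrC.
Qed.

Lemma tperm_disjC n (a b c d : 'I_n) : uniq [:: a; b; c; d] ->
  (tperm a b * tperm c d = tperm c d * tperm a b)%g.
Proof.
rewrite /= !inE !negb_or -!andbA => /and5P[ab ac ad bc /and3P[bd cd _]].
by rewrite conjgC tpermJ !tpermD // eq_sym.
Qed.

Lemma diff_shift n (V : zmodType) (f : 'S_n -> V) l a b x :
    uniq (ends ((a, b) :: l)) ->
  diff (fun y => f (tperm a b * y)%g) l x = diff f l (tperm a b * x)%g.
Proof.
elim: l x => // -[c d] l IH x; rewrite !diff_cons /= !inE !negb_or -!andbA.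
case/and5P=> ab ac ad al /and5P[bc bd bl cd /and3P[cl dl ul]].
have u1 : uniq (ends ((a, b) :: l)) by rewrite /= !inE negb_or ab al bl ul.
rewrite !IH //; congr (_ - diff f l _); rewrite !mulgA; congr (_ * _)%g.
by apply: tperm_disjC; rewrite /= !inE !negb_or ab ac ad bc bd cd.
Qed.

Lemma eq_diff n (V : zmodType) (f g : 'S_n -> V) l x :
  f =1 g -> diff f l x = diff g l x.
Proof. by move=> e; elim: l x => // p l IH x; rewrite !diff_cons !IH. Qed.

Lemma diff_tperm n (V : zmodType) (f : 'S_n -> V) l a b x :
    uniq (ends ((a, b) :: l)) -> (forall y, f (tperm a b * y)%g = f y) ->
  diff f l (tperm a b * x)%g = diff f l x.
Proof. by move=> u inv; rewrite -diff_shift //; apply: eq_diff. Qed.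

(** One factor 1 - tau that kills f is enough, since disjoint transpositions
    commute and the factor can be applied first. *)
Lemma diff_eq0 n (V : zmodType) (f : 'S_n -> V) l p x :
    uniq (ends l) -> p \in l -> (forall y, f (tperm p.1 p.2 * y)%g = f y) ->
  diff f l x = 0.
Proof.
elim: l x => // q l IH x /[dup] u /=; rewrite inE => /and3P[_ _ ul].
case/orP=> [/eqP ->|pl] inv; last by rewrite !(IH _ ul pl inv) subrr.
by rewrite diff_tperm ?subrr //; case: (q) u.
Qed.

Lemma contains_tperm n (m : {set 'I_n * 'I_n}) a b x :
    a \notin [set p.1 | p in m] -> b \notin [set p.1 | p in m] ->
  contains m (tperm a b * x)%g = contains m x.
Proof.
move=> am bm; apply: eq_forallb_in => -[i j] /= ij.
have im : i \in [set p.1 | p in m] by apply/imsetP; exists (i, j).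
rewrite permM tpermD //; [move: am|move: bm]; apply: contraNneq => -> //.
Qed.

Lemma pair_outside n (D : {set 'I_n}) l : uniq (ends l) -> (#|D| < size l)%N ->
  exists2 p, p \in l & (p.1 \notin D) && (p.2 \notin D).
Proof.
move=> u lt; apply/hasP; apply/negPn/negP=> /hasPn h.
have: (size l <= count [in D] (ends l))%N.
  elim: l h {u lt} => //= q l IH h.
  have := h q (mem_head _ _); rewrite -negb_or negbK.
  have := IH (fun p pl => h p (mem_behead (s := q :: l) pl)).
  by case: (q.1 \in D); case: (q.2 \in D) => //=; lia.
rewrite -size_filter => H.
have : (size [seq x <- ends l | x \in D] <= #|D|)%N.
  rewrite cardE; apply: uniq_leq_size; first exact: filter_uniq.
  by move=> x; rewrite mem_filter mem_enum => /andP[].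
by move=> H2; have := leq_trans H H2; rewrite leqNgt lt.
Qed.

(** A matching with at most t pairs leaves one of the t + 1 disjoint transpositions
    untouched, and that factor annihilates its indicator. *)
Lemma cube_null n t l (x : 'S_n) : uniq (ends l) -> (t < size l)%N ->
  null t (cube l x).
Proof.
move=> u lt m mt; rewrite stat_cube.
have ltD : (#|[set p.1 | p in m]| < size l)%N.
  by apply: leq_ltn_trans lt; apply: leq_trans mt; apply: leq_imset_card.
have [p pl /andP[p1 p2]] := pair_outside u ltD.
by apply: (diff_eq0 _ u pl) => y; rewrite contains_tperm.
Qed.

(** * Telescoping *)

(** The recursion behind the telescoping: rebasing a cube costs K, and each of the
    at most n steps to the new base leaves a cube with one more factor. *)
Fixpoint cost (n K j : nat) : nat := if j is j'.+1 then K + n * cost n K j' else 0.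

Lemma cost_le n K j : (0 < n)%N -> (cost n K j <= j * K * n ^ j)%N.
Proof.
move=> n0; elim: j => //= j IH.
have := expn_gt0 n j.+1; rewrite n0 /= => h; rewrite expnS in h *; nia.
Qed.

Lemma cube_rebase n l a b (x : 'S_n) :
  cube l x = cube l (tperm a b * x)%g + cube ((a, b) :: l) x.
Proof. by rewrite [X in _ + X]/cube diff_cons addrC subrK. Qed.

(** [Rep k u] is meant to say that u has a representation of size k modulo null
    functions of order t. Keeping it abstract lets one induction serve two
    purposes: [Rep_base] leaves the choice of the new base y to the instance,
    which may take it fresh or canonical. *)
Section Telescoping.
Variables (n t K : nat) (Rep : nat -> {ffun 'S_n -> rat} -> Prop).
Hypothesis RepW : forall j k u, (j <= k)%N -> Rep j u -> Rep k u.
Hypothesis RepD : forall j k u v, Rep j u -> Rep k v -> Rep (j + k) (u + v).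
Hypothesis Rep_top : forall l x, uniq (ends l) -> size l = t.+1 -> Rep 0 (cube l x).
Hypothesis Rep0 : Rep 0 0.
Hypothesis Rep_base : forall c l (x : 'S_n), uniq (ends l) -> (size l <= t)%N ->
  (forall y : 'S_n, {in ends l, forall i, x i = y i} -> Rep c (cube l x - cube l y)) ->
  Rep (K + c) (cube l x).

(** The walk from x to y moves along transpositions of points where the current
    permutation differs from y. Such points avoid the ends of l, where x and y
    agree, so each step adds a genuine new factor to the cube. *)
Lemma Rep_walk c l (y : 'S_n) d (x : 'S_n) :
    (forall a b z, uniq [:: a, b & ends l] -> Rep c (cube ((a, b) :: l) z)) ->
    uniq (ends l) ->
    {in ends l, forall i, x i = y i} -> (#|[set i | x i != y i]| <= d)%N ->
  Rep (d * c) (cube l x - cube l y).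
Proof.
move=> hc ul; elim: d x => [|d IH] x agr.
  rewrite leqn0 cards_eq0 => /eqP e; rewrite mul0n.
  suff -> : x = y by rewrite subrr.
  apply/permP => i; apply/eqP; apply/negPn; apply/negP => ne.
  by have := in_set0 i; rewrite -e inE ne.
case: (altP (x =P y)) => [-> _|ne le]; first by rewrite subrr; apply: RepW Rep0.
have [a ha] : exists a, x a != y a.
  apply/existsP; apply: contraNT ne => /existsPn h; apply/eqP.
  by apply/permP => i; apply/eqP; have := h i; rewrite negbK.
(* The transposition of a and b makes x agree with y at a. *)
pose b := (x^-1)%g (y a).
have xb : x b = y a by rewrite permKV.
have yb : x b != y b.
  rewrite xb; apply: contraNneq ha => /perm_inj e; by rewrite {1}e xb.
have ab : a != b by apply: contraNneq ha => e; rewrite {1}e xb.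
have al : a \notin ends l by apply: contraNN ha => /agr ->.
have bl : b \notin ends l by apply: contraNN yb => /agr ->.
have xi i : x i == y i -> (tperm a b * x)%g i = y i.
  move=> xy; rewrite permM tpermD ?(eqP xy) //.
    by apply: contraNneq ha => ->.
  by apply: contraNneq yb => ->.
rewrite (cube_rebase l a b) mulSn addnC addrAC.
apply: RepD; last by apply: hc; rewrite /= inE negb_or ab al bl.
apply: IH => [i il|].
  by apply/esym; rewrite xi // agr.
have lt : [set i | (tperm a b * x)%g i != y i] \proper [set i | x i != y i].
  apply/properP; split.
    by apply/subsetP => i; rewrite !inE; apply: contraNN => /xi ->.
  by exists a; rewrite !inE // permM tpermL xb eqxx.
by have := leq_trans (proper_card lt) le.
Qed.

Lemma Rep_cube j l x : uniq (ends l) -> (size l + j)%N = t.+1 ->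
  Rep (cost n K j) (cube l x).
Proof.
elim: j l x => [|j IH] l x ul sz; first by apply: Rep_top; rewrite // -sz addn0.
apply: Rep_base => // [|y agr]; first by lia.
apply: Rep_walk => //; last by rewrite -[leqRHS]card_ord max_card.
by move=> a b z u; apply: IH => //=; lia.
Qed.

Lemma Rep_delta x : Rep (cost n K t.+1) (delta x).
Proof. exact: (@Rep_cube _ [::]). Qed.

End Telescoping.

(** * Fresh signed representations *)

Definition ind n (P : {set 'S_n}) : {ffun 'S_n -> rat} := [ffun y => (y \in P)%:R].

Lemma disjI (T : finType) (A B : {set T}) :
  (forall y, y \in A -> y \in B -> false) -> [disjoint A & B].
Proof.
move=> h; apply/pred0P => y /=; apply/negP => /andP[yA yB].
by have := h y yA yB.
Qed.

Lemma indU n (P Q : {set 'S_n}) : [disjoint P & Q] ->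
  ind (P :|: Q) = ind P + ind Q.
Proof.
move=> d; apply/ffunP => y; rewrite !ffunE inE.
have := disjointFr d (x := y).
by case: (y \in P) => [->|_] //=; rewrite ?addr0 ?add0r.
Qed.

(** The permutations that occur in [cube l x]. *)
Fixpoint corner n (l : seq ('I_n * 'I_n)) (x : 'S_n) : {set 'S_n} :=
  if l is p :: l' then corner l' x :|: corner l' (tperm p.1 p.2 * x)%g else [set x].

Lemma corner_agree n (l : seq ('I_n * 'I_n)) x y i :
  y \in corner l x -> i \notin ends l -> y i = x i.
Proof.
elim: l x => [|p l IH] x /=; first by rewrite inE => /eqP ->.
rewrite !inE !negb_or => h /and3P[i1 i2 il].
case/orP: h => /IH -> //; by rewrite permM tpermD // eq_sym.
Qed.

(** Bounds the number of bases that must be avoided to keep a cube off the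
    permutation g. *)
Lemma card_cocorner n (l : seq ('I_n * 'I_n)) g :
  (#|[set y | g \in corner l y]| <= 2 ^ size l)%N.
Proof.
elim: l => [|p l IH] /=.
  rewrite (_ : [set y | _] = [set g]) ?cards1 //.
  by apply/setP => y; rewrite !inE eq_sym.
pose A := [set y | g \in corner l y].
pose B := [set y | g \in corner l (tperm p.1 p.2 * y)%g].
have -> : [set y | g \in corner l y :|: corner l (tperm p.1 p.2 * y)%g] = A :|: B.
  by apply/setP => y; rewrite !inE.
have AB : (#|B| <= #|A|)%N.
  rewrite -(card_imset (mem B) (mulgI (tperm p.1 p.2))).
  apply: subset_leq_card; apply/subsetP => _ /imsetP[y yB ->].
  by move: yB; rewrite !inE.
apply: leq_trans (leq_card_setU A B).1 _; rewrite expnS mul2n -addnn.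
by apply: leq_add => //; apply: leq_trans IH.
Qed.

Lemma card_corner n (l : seq ('I_n * 'I_n)) x : (#|corner l x| <= 2 ^ size l)%N.
Proof.
elim: l x => [|p l IH] x /=; first by rewrite cards1.
apply: leq_trans (leq_card_setU _ _).1 _; rewrite expnS mul2n -addnn.
exact: leq_add.
Qed.

(** A cube has coefficients 0, 1 and -1: at the first point of a pair of l the two
    halves of the cube take different values, so they do not overlap. *)
Lemma cube_signed n (l : seq ('I_n * 'I_n)) x : uniq (ends l) ->
  exists P Q : {set 'S_n}, [/\ [disjoint P & Q], P :|: Q \subset corner l x,
    (#|P| + #|Q| <= 2 ^ size l)%N & cube l x = ind P - ind Q].
Proof.
elim: l x => [|p l IH] x.
  move=> _; exists [set x], set0; split=> //.
  - by rewrite disjoint_sym disjoints_subset sub0set.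
  - by rewrite setU0.
  - by rewrite cards1 cards0.
  by apply/ffunP => y; rewrite !ffunE !inE subr0.
rewrite /= inE negb_or -andbA => /and4P[pp p1 p2 ul].
have [P1 [Q1 [d1 s1 c1 e1]]] := IH x ul.
have [P2 [Q2 [d2 s2 c2 e2]]] := IH (tperm p.1 p.2 * x)%g ul.
have dis y : y \in P1 :|: Q1 -> y \in P2 :|: Q2 -> false.
  move=> /(subsetP s1) h1 /(subsetP s2) h2.
  have := corner_agree h2 p1; rewrite (corner_agree h1 p1) permM tpermL.
  by move/perm_inj/eqP; rewrite (negbTE pp).
exists (P1 :|: Q2), (Q1 :|: P2); split.
- apply: disjI => y; rewrite !inE => /orP[] h1 /orP[] h2.
  + by rewrite (disjointFr d1 h1) in h2.
  + by apply: (dis y); rewrite inE ?h1 ?h2 ?orbT.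
  + by apply: (dis y); rewrite inE ?h1 ?h2 ?orbT.
  + by rewrite (disjointFl d2 h1) in h2.
- have h1 := subsetP s1; have h2 := subsetP s2.
  apply/subsetP => y; rewrite !inE -!orbA.
  case/or4P=> h; first [by rewrite h1 // inE h ?orbT
                       |by rewrite h2 ?orbT // inE h ?orbT].
- apply: leq_trans (leq_add (leq_card_setU P1 Q2).1 (leq_card_setU Q1 P2).1) _.
  by rewrite addnACA expnS mul2n -addnn [X in (_ + X)%N]addnC; apply: leq_add.
rewrite /cube diff_cons -/(cube l x) -/(cube l _) e1 e2 !indU.
- by rewrite opprB opprD addrACA.
- by apply: disjI => y yQ yP; apply: (dis y); rewrite inE ?yQ ?yP ?orbT.
by apply: disjI => y yQ yP; apply: (dis y); rewrite inE ?yQ ?yP ?orbT.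
Qed.

Lemma card_agree n (l : seq 'I_n) (x : 'S_n) :
  ((n - size l)`! <= #|[set y : 'S_n | all (fun i => x i == y i) l]|)%N.
Proof.
pose A : {set 'I_n} := ~: [set i in l].
have cA : (n - size l <= #|A|)%N.
  rewrite cardsCs setCK card_ord; apply: leq_sub2l.
  by rewrite cardsE card_size.
apply: (leq_trans (leq_fact cA)); rewrite -card_perm.
rewrite -(card_imset (perm_on A) (mulIg x)).
apply: subset_leq_card; apply/subsetP => _ /imsetP[s sA ->].
rewrite inE; apply/allP => i il; rewrite permM (out_perm sA) //.
by rewrite !inE il.
Qed.

Lemma card_bigcup_le (T I : finType) (F : {set I}) (A : I -> {set T}) c :
  (forall g, (#|A g| <= c)%N) -> (#|\bigcup_(g in F) A g| <= c * #|F|)%N.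
Proof.
move=> h; apply: (@leq_trans (\sum_(g in F) #|A g|)%N).
  elim/big_rec2: _ => [|g m X _ IH]; first by rewrite cards0.
  by apply: leq_trans (leq_card_setU _ _).1 _; rewrite leq_add2l.
by rewrite mulnC -sum_nat_const; apply: leq_sum.
Qed.

Lemma signedD n t (Forb P1 Q1 P2 Q2 : {set 'S_n}) (w : {ffun 'S_n -> rat}) :
    [disjoint P1 & Q1] -> [disjoint P2 & Q2] -> [disjoint P1 :|: Q1 & Forb] ->
    [disjoint P2 :|: Q2 & Forb :|: (P1 :|: Q1)] -> null t (w - (ind P2 - ind Q2)) ->
  exists P Q : {set 'S_n}, [/\ [disjoint P & Q], [disjoint P :|: Q & Forb],
    (#|P| + #|Q| <= #|P1| + #|Q1| + (#|P2| + #|Q2|))%N &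
    null t (ind P1 - ind Q1 + w - (ind P - ind Q))].
Proof.
move=> d1 d2 f1 f2 n2.
have dis y : y \in P1 :|: Q1 -> y \in P2 :|: Q2 -> false.
  by move=> y1 y2; have := disjointFr f2 y2; rewrite in_setU y1 orbT.
exists (P1 :|: P2), (Q1 :|: Q2); split.
- apply: disjI => y; rewrite !inE => /orP[] h1 /orP[] h2.
  + by rewrite (disjointFr d1 h1) in h2.
  + by apply: (dis y); rewrite inE ?h1 ?h2 ?orbT.
  + by apply: (dis y); rewrite inE ?h1 ?h2 ?orbT.
  + by rewrite (disjointFr d2 h1) in h2.
- apply: disjI => y; rewrite setUACA in_setU => /orP[y1 yF|y2 yF].
    by rewrite (disjointFr f1 y1) in yF.
  by have := disjointFr f2 y2; rewrite in_setU yF.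
- apply: leq_trans (leq_add (leq_card_setU P1 P2).1 (leq_card_setU Q1 Q2).1) _.
  by rewrite addnACA.
move=> m /n2 <-; apply: eq_stat => y.
rewrite !indU; first by rewrite !ffunE; lra.
  by apply: disjI => z yQ yP; apply: (dis z); rewrite inE ?yQ ?yP ?orbT.
by apply: disjI => z yQ yP; apply: (dis z); rewrite inE ?yQ ?yP ?orbT.
Qed.

(** Quantifying over all small forbidden sets inside the definition is what makes
    it additive: representations of two summands are made disjoint by forbidding
    the first when choosing the second. *)
Definition fresh n t k (u : {ffun 'S_n -> rat}) :=
  forall Forb : {set 'S_n}, (2 ^ t * (#|Forb| + k) < (n - t.*2)`!)%N ->
  exists P Q : {set 'S_n}, [/\ [disjoint P & Q], [disjoint P :|: Q & Forb],
    (#|P| + #|Q| <= k)%N & null t (u - (ind P - ind Q))].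

Lemma freshW n t j k (u : {ffun 'S_n -> rat}) : (j <= k)%N -> fresh t j u -> fresh t k u.
Proof.
move=> jk h Forb lt; have [|P [Q [d1 d2 c nl]]] := h Forb.
  by apply: leq_ltn_trans lt; rewrite leq_mul2l leq_add2l jk orbT.
by exists P, Q; split=> //; apply: leq_trans jk.
Qed.

Lemma freshD n t j k (u v : {ffun 'S_n -> rat}) :
  fresh t j u -> fresh t k v -> fresh t (j + k) (u + v).
Proof.
move=> hu hv Forb lt.
have [|P1 [Q1 [d1 f1 c1 n1]]] := hu Forb.
  by apply: leq_ltn_trans lt; rewrite leq_mul2l leq_add2l leq_addr orbT.
have [|P2 [Q2 [d2 f2 c2 n2]]] := hv (Forb :|: (P1 :|: Q1)).
  apply: leq_ltn_trans lt; rewrite leq_mul2l addnA leq_add2r; apply/orP; right.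
  apply: leq_trans (leq_card_setU _ _).1 _; rewrite leq_add2l.
  exact: leq_trans (leq_card_setU _ _).1 c1.
have [P [Q [d f c nl]]] := signedD d1 d2 f1 f2 n2.
exists P, Q; split=> //; first by apply: leq_trans c (leq_add c1 c2).
by apply: eq_null (nullD n1 nl) => y; rewrite !ffunE; lra.
Qed.

(** Only the values at the 2 |l| ends of a cube are prescribed for its new base,
    so (n - 2 |l|)! bases are available and a counting argument finds one whose
    cube avoids the forbidden set. *)
Lemma fresh_delta n t (x : 'S_n) :
  fresh t (cost n (2 ^ t) t.+1) (delta x).
Proof.
apply: Rep_delta => [j k u|j k u v|l y ul sz||c l y ul sz h].
- exact: freshW.
- exact: freshD.
- move=> Forb _; exists set0, set0; split.
  + by apply: disjI => z; rewrite inE.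
  + by apply: disjI => z; rewrite !inE.
  + by rewrite cards0.
  by rewrite subrr subr0; apply: cube_null => //; rewrite sz.
- move=> Forb _; exists set0, set0; split.
  + by apply: disjI => z; rewrite inE.
  + by apply: disjI => z; rewrite !inE.
  + by rewrite cards0.
  by apply: eq_null (@null0 _ _) => z; rewrite !ffunE; lra.
move=> Forb lt.
have [z az zF] : exists2 z : 'S_n, {in ends l, forall i, y i = z i}
    & [disjoint corner l z & Forb].
  pose A := [set z : 'S_n | all (fun i => y i == z i) (ends l)].
  pose bad := \bigcup_(g in Forb) [set z : 'S_n | g \in corner l z].
  have h1 : (#|bad| <= 2 ^ t * #|Forb|)%N.
    apply: card_bigcup_le => g; apply: leq_trans (card_cocorner l g) _.
    by rewrite leq_exp2l.
  have h2 : (2 ^ t * #|Forb| < (n - t.*2)`!)%N.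
    by apply: leq_ltn_trans lt; rewrite leq_mul2l leq_addr orbT.
  have h3 : ((n - t.*2)`! <= #|A|)%N.
    apply: leq_trans (card_agree _ _); apply: leq_fact.
    by rewrite leq_sub2l // size_ends leq_double.
  have [z zA zb] : exists2 z, z \in A & z \notin bad.
    apply/subsetPn; apply/negP => /subset_leq_card.
    by rewrite leqNgt (leq_ltn_trans h1 (leq_trans h2 h3)).
  exists z; first by move: zA; rewrite inE => /allP za i il; apply/eqP/za.
  apply: disjI => g gz gF; case/negP: zb.
  by apply/bigcupP; exists g; rewrite ?inE.
have [P1 [Q1 [d1 s1 c1 e1]]] := cube_signed z ul.
have c1' : (#|P1 :|: Q1| <= 2 ^ t)%N.
  apply: leq_trans (leq_card_setU _ _).1 (leq_trans c1 _).
  by rewrite leq_exp2l.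
have [|P2 [Q2 [d2 f2 c2 n2]]] := h z az (Forb :|: (P1 :|: Q1)).
  apply: leq_ltn_trans lt; rewrite leq_mul2l addnA leq_add2r; apply/orP; right.
  by apply: leq_trans (leq_card_setU _ _).1 _; rewrite leq_add2l.
have f1 : [disjoint P1 :|: Q1 & Forb] by apply: disjointWl zF.
have [P [Q [d f cc nl]]] := signedD d1 d2 f1 f2 n2.
exists P, Q; split=> //.
  by apply: leq_trans cc _; apply: leq_add => //; apply: leq_trans c1 _; rewrite leq_exp2l.
apply: eq_null nl => y'; rewrite !ffunE. 
have := congr1 (fun f : {ffun 'S_n -> rat} => f y') e1; rewrite !ffunE => ->; lra.
Qed.

(** * Toggles and spreading *)

Notation delta_cost n t := (cost n (2 ^ t) t.+1).

(** Each entry x of xs gets its own fresh pair P, Q with x congruent to 1_P - 1_Q.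
    The base set G0 takes Q for every entry; replacing Q by P adds x once. *)
Lemma toggle_set n t (xs : seq 'S_n) :
    (2 ^ t * (delta_cost n t * size xs) < (n - t.*2)`!)%N ->
  exists R G0 : {set 'S_n}, [/\ G0 \subset R, (#|R| <= delta_cost n t * size xs)%N &
    forall nu : 'S_n -> nat, (forall b, (nu b <= count_mem b xs)%N) ->
    exists2 G : {set 'S_n}, G \subset R &
      null t (fun y => ind G y - ind G0 y - (nu y)%:R)].
Proof.
elim: xs => [|x xs IH] lt.
  exists set0, set0; split; rewrite ?sub0set ?cards0 //.
  move=> nu h; exists set0; first exact: sub0set.
  apply: eq_null (@null0 _ _) => y; have := h y; rewrite leqn0 => /eqP ->.
  by rewrite !subrr.
have [|R [G0 [sG0 cR hR]]] := IH.
  apply: leq_ltn_trans lt; rewrite leq_mul2l /= mulnS leq_addl orbT //.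
have [|P [Q [d f c nl]]] := @fresh_delta n t x R.
  apply: leq_ltn_trans lt; rewrite leq_mul2l /= mulnS addnC leq_add2l cR orbT //.
have offR (S G : {set 'S_n}) : S \subset P :|: Q -> G \subset R -> [disjoint G & S].
  by move=> sS sG; rewrite disjoint_sym; apply: disjointW f.
exists (R :|: (P :|: Q)), (G0 :|: Q); split.
- by rewrite setUSS // subsetUr.
- apply: leq_trans (leq_card_setU _ _).1 _; rewrite /= mulnS addnC.
  by apply: leq_add => //; apply: leq_trans (leq_card_setU _ _).1 c.
move=> nu hnu.
have [le|gt] := leqP (nu x) (count_mem x xs).
  have [b|G sG nG] := hR nu.
    by have := hnu b; rewrite /=; case: (altP (x =P b)) => [<-|].
  exists (G :|: Q); first by rewrite setUSS // subsetUr.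
  apply: eq_null nG => y.
  by rewrite !indU ?offR ?subsetUr // !ffunE; lra.
have [b|G sG nG] := hR (fun b => nu b - (b == x))%N.
  by have := hnu b; rewrite /= (eq_sym b) leq_subLR.
exists (G :|: P); first by rewrite setUSS // subsetUl.
apply: eq_null (nullB nG nl) => y.
rewrite !indU ?offR ?subsetUr ?subsetUl // !ffunE.
rewrite natrB; first by lra.
by case: (altP (y =P x)) => [->|//]; apply: leq_trans gt.
Qed.

Lemma spread_aux n k (Forb : {set 'S_n}) (x : 'S_n) r :
    (2 ^ k * (#|Forb| + delta_cost n k * r) < (n - k.*2)`!)%N ->
  exists (S : {set 'S_n}) (s : 'S_n -> rat),
    [/\ [disjoint S & Forb], (#|S| <= delta_cost n k * r)%N,
        forall y, y \notin S -> s y = 0, forall y, `|s y| <= 1 &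
        null k (fun y => r%:R * delta x y - s y)].
Proof.
elim: r => [|r IH] lt.
  exists set0, (fun _ => 0); split; rewrite ?cards0 //.
  - by apply: disjI => y; rewrite inE.
  by apply: eq_null (@null0 _ _) => y; rewrite mul0r subr0.
have [|S [s [dS cS s0 s1 ns]]] := IH.
  by apply: leq_ltn_trans lt; rewrite leq_mul2l leq_add2l leq_mul2l leqnSn !orbT.
have [|P [Q [d f c nl]]] := @fresh_delta n k x (Forb :|: S).
  apply: leq_ltn_trans lt; rewrite leq_mul2l; apply/orP; right.
  rewrite mulnS [X in (_ <= _ + X)%N]addnC addnA leq_add2r.
  by apply: leq_trans (leq_card_setU _ _).1 _; rewrite leq_add2l.
exists (S :|: (P :|: Q)), (fun y => s y + (ind P y - ind Q y)); split.
- apply: disjI => y; rewrite in_setU => /orP[yS yF|yPQ yF].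
    by rewrite (disjointFr dS yS) in yF.
  by have := disjointFr f yPQ; rewrite in_setU yF.
- apply: leq_trans (leq_card_setU _ _).1 _; rewrite mulnS addnC.
  by apply: leq_add => //; apply: leq_trans (leq_card_setU _ _).1 c.
- move=> y; rewrite !inE !negb_or => /and3P[/s0 -> yP yQ].
  by rewrite !ffunE (negbTE yP) (negbTE yQ); lra.
- move=> y; rewrite !ffunE.
  have [yPQ|] := boolP (y \in P :|: Q).
    have := disjointFr f yPQ; rewrite in_setU => /norP[_ /s0 ->]; have := @disjointFr _ _ _ y d.
    by case: (y \in P) => [->|_]; case: (y \in Q); rewrite ?add0r ?subr0 ?sub0r ?normrN ?normr1 ?normr0.
  by rewrite inE => /norP[/negbTE -> /negbTE ->]; rewrite subrr addr0.
apply: eq_null (nullD ns nl) => y; rewrite !ffunE -natr1; lra.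
Qed.

(** Averaging r pairwise disjoint fresh representations of x makes every
    coefficient at most 1/r. *)
Lemma spread n k (Forb : {set 'S_n}) r : (0 < r)%N ->
    (2 ^ k * (#|Forb| + delta_cost n k * r) < (n - k.*2)`!)%N ->
  exists s : 'S_n -> 'S_n -> rat, forall x,
    [/\ forall y, y \in Forb -> s x y = 0, forall y, `|s x y| <= r%:R^-1 &
        null k (fun y => delta x y - s x y)].
Proof.
move=> r0 lt; have rn0 : r%:R != 0 :> rat by rewrite pnatr_eq0 -lt0n.
suff /fin_all_exists : forall x : 'S_n, exists s : 'S_n -> rat,
  [/\ forall y, y \in Forb -> s y = 0, forall y, `|s y| <= r%:R^-1 &
        null k (fun y => delta x y - s y)] by [].
move=> x; have [S [s [dS cS s0 s1 ns]]] := spread_aux x lt.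
exists (fun y => r%:R^-1 * s y); split.
- move=> y yF; rewrite s0 ?mulr0 //; apply/negP => yS.
  by rewrite (disjointFr dS yS) in yF.
- move=> y; rewrite normrM ger0_norm ?invr_ge0 ?ler0n //.
  by rewrite ler_piMr // invr_ge0 ler0n.
apply: eq_null (nullZ r%:R^-1 ns) => y.
by rewrite mulrBr mulrA mulVf // mul1r.
Qed.

(** * A small set of generators *)

(** A base for the cubes over l that depends only on the values at the ends of l. *)
Definition canon n (l : seq ('I_n * 'I_n)) (v : seq 'I_n) : 'S_n :=
  odflt 1%g [pick y : 'S_n | [seq y i | i <- ends l] == v].

Lemma canonP n (l : seq ('I_n * 'I_n)) (x : 'S_n) :
  {in ends l, forall i, x i = canon l [seq x i | i <- ends l] i}.
Proof.
move=> i il; rewrite /canon; case: pickP => [y /eqP/eq_in_map -> //|/(_ x)].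
by rewrite eqxx.
Qed.

Definition generators n t : {set 'S_n} :=
  \bigcup_(s in [set: 'I_t.+1])
    \bigcup_(q in [set: s.-tuple ('I_n * 'I_n) * (s.*2).-tuple 'I_n])
      corner q.1 (canon q.1 q.2).

Lemma card_generators n t : (0 < n)%N ->
  (#|generators n t| <= 2 ^ t * n ^ (4 * t) * t.+1)%N.
Proof.
move=> n0; rewrite /generators -[t.+1 in leqRHS]card_ord -cardsT.
apply: card_bigcup_le => s; have st : (s <= t)%N by rewrite -ltnS.
apply: leq_trans (@card_bigcup_le _ _ _ _ (2 ^ t)%N _) _.
  move=> q; apply: leq_trans (card_corner _ _) _; rewrite size_tuple.
  by rewrite leq_exp2l.
rewrite leq_mul2l cardsT card_prod !card_tuple card_prod !card_ord.
apply/orP; right; rewrite mulnn -expnM -expnD leq_pexp2l //; lia.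
Qed.

Lemma mem_generators n t l (x y : 'S_n) : (size l <= t)%N ->
  y \in corner l (canon l [seq x i | i <- ends l]) -> y \in generators n t.
Proof.
move=> lt yc; have lt' : (size l < t.+1)%N by [].
apply/bigcupP; exists (Ordinal lt') => //; apply/bigcupP.
have sz : size [seq x i | i <- ends l] == (size l).*2 by rewrite size_map size_ends.
by exists (in_tuple l, Tuple sz).
Qed.

Definition generated n t k (u : {ffun 'S_n -> rat}) :=
  exists g : {ffun 'S_n -> rat},
    [/\ forall y, y \notin generators n t -> g y = 0, forall y, g y \is a Num.int,
        \sum_y `|g y| <= k%:R & null t (u - g)].

Lemma generatedD n t j k (u v : {ffun 'S_n -> rat}) :
  generated t j u -> generated t k v -> generated t (j + k) (u + v).
Proof.
move=> [g [g0 gi gs gn]] [h [h0 hi hs hn]]; exists (g + h); split.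
- by move=> y yB; rewrite ffunE g0 // h0 // addr0.
- by move=> y; rewrite ffunE rpredD.
- rewrite natrD; apply: le_trans (lerD gs hs); rewrite -big_split.
  by apply: ler_sum => y _; rewrite ffunE ler_normD.
by apply: eq_null (nullD gn hn) => y; rewrite !ffunE; lra.
Qed.

Lemma generated0 n t (u : {ffun 'S_n -> rat}) : null t u -> generated t 0 u.
Proof.
move=> nu; exists 0; split=> [y _|y||].
- by rewrite ffunE.
- by rewrite ffunE.
- by rewrite big1 // => y _; rewrite ffunE normr0.
by apply: eq_null nu => y; rewrite !ffunE subr0.
Qed.

Lemma generated_delta n t (x : 'S_n) : generated t (delta_cost n t) (delta x).
Proof.
apply: Rep_delta => [j k u jk|j k u v|l y ul sz||c l y ul sz h].
- case=> g [g0 gi gs gn]; exists g; split=> //.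
  by apply: le_trans gs _; rewrite ler_nat.
- exact: generatedD.
- by apply: generated0; apply: cube_null; rewrite ?sz.
- by apply: generated0; apply: eq_null (@null0 _ _) => y; rewrite ffunE.
pose z := canon l [seq y i | i <- ends l].
rewrite -[cube l y](subrK (cube l z)) addrC; apply: generatedD; last first.
  exact/h/canonP.
have [P [Q [d s cc e]]] := cube_signed z ul.
have PQ w : w \notin generators n t -> (w \in P = false) * (w \in Q = false).
  move=> wB; split; apply: contraNF wB => wP; apply: (mem_generators sz (x := y));
    by apply: (subsetP s); rewrite inE wP ?orbT.
exists (ind P - ind Q); split.
- by move=> w /PQ[wP wQ]; rewrite !ffunE wP wQ subrr.
- by move=> w; rewrite !ffunE rpredB // rpred_nat.
- apply: (@le_trans _ _ (#|P| + #|Q|)%:R); last first.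
    by rewrite ler_nat; apply: leq_trans cc _; rewrite leq_exp2l.
  rewrite natrD -!sum1_card !natr_sum [X in _ <= X + _]big_mkcond.
  rewrite [X in _ <= _ + X]big_mkcond -big_split; apply: ler_sum => w _ /=.
  rewrite !ffunE; case: (w \in P); case: (w \in Q);
    by rewrite ?subrr ?subr0 ?sub0r ?normrN ?normr0 ?normr1 ?addr0 ?add0r ?ler01 ?addr_ge0.
by rewrite e subrr; apply: eq_null (@null0 _ _) => w; rewrite ffunE.
Qed.

(** With canonical bases the telescoping uses cubes that are indexed by at most t
    pairs of points and the values there, so the permutations involved form a
    set of size n^O(t). *)
Lemma decode n t : exists dec : 'S_n -> 'S_n -> rat, forall x,
  [/\ forall y, y \notin generators n t -> dec x y = 0,
      forall y, dec x y \is a Num.int,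
      \sum_y `|dec x y| <= (delta_cost n t)%:R &
      null t (fun y => delta x y - dec x y)].
Proof.
suff /fin_all_exists : forall x : 'S_n, exists g : 'S_n -> rat,
  [/\ forall y, y \notin generators n t -> g y = 0,
      forall y, g y \is a Num.int, \sum_y `|g y| <= (delta_cost n t)%:R &
      null t (fun y => delta x y - g y)] by [].
move=> x; have [g [g0 gi gs gn]] := generated_delta t x; exists g; split=> //.
by apply: eq_null gn => y; rewrite !ffunE.
Qed.

(** * Null functions are spanned by cubes *)

Lemma stat_mul n (s : 'S_n) (m : {set 'I_n * 'I_n}) w :
  stat m (fun x => w (s * x)%g) = stat [set ((s^-1)%g p.1, p.2) | p in m] w.
Proof.
rewrite /stat [RHS](reindex_inj (mulgI s)) /=; apply: eq_bigl => x.
apply/containsP/containsP => h i j.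
  by case/imsetP=> -[i' j'] /h /= e [-> ->]; rewrite permM permKV.
move=> ij; have := h (s^-1 i)%g j; rewrite permM permKV; apply.
by apply/imsetP; exists (i, j).
Qed.

Lemma null_mul n k (s : 'S_n) w : null k w -> null k (fun x => w (s * x)%g).
Proof.
move=> h m hm; rewrite stat_mul h //.
exact: leq_trans (leq_imset_card _ _) hm.
Qed.

Lemma null_restrict n k (m0 : {set 'I_n * 'I_n}) w : null (k + #|m0|) w ->
  null k (fun x => (contains m0 x)%:R * w x).
Proof.
move=> h m hm; rewrite -(h (m :|: m0)).
  rewrite /stat big_mkcond [RHS]big_mkcond; apply: eq_bigr => x _.
  have -> : contains (m :|: m0) x = contains m x && contains m0 x.
    apply/containsP/andP => [c|[/containsP c1 /containsP c2] i j].
      by split; apply/containsP => i j ij; apply: c; rewrite inE ij ?orbT.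
    by rewrite inE => /orP[/c1|/c2].
  by case: (contains m x); case: (contains m0 x); rewrite ?mul1r ?mul0r.
by apply: leq_trans (leq_card_setU _ _).1 _; rewrite leq_add2r.
Qed.

Lemma sum0_null n k (w : 'S_n -> rat) : null k w -> \sum_x w x = 0.
Proof.
move=> h; apply: etrans (h set0 _); last by rewrite cards0.
apply: eq_bigl => x.
by apply/esym/containsP => i j; rewrite inE.
Qed.

Lemma diffB n (V : zmodType) (f g : 'S_n -> V) l x :
  diff (fun y => f y - g y) l x = diff f l x - diff g l x.
Proof.
by elim: l x => // p l IH x; rewrite !diff_cons !IH !opprD !opprK addrACA.
Qed.

Section Orthogonality.
Variable n : nat.
Implicit Types (f w : 'S_n -> rat) (U : {set 'I_n}).

(** The induction conditions on the values at a growing set U of points. *)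
Definition fiber U (x0 : 'S_n) : {set 'S_n} := [set x : 'S_n | [forall i in U, x i == x0 i]].

Lemma fiberP U (x0 x : 'S_n) : reflect {in U, forall i, x i = x0 i} (x \in fiber U x0).
Proof.
by rewrite inE; apply: (iffP forall_inP) => h i /h // => [/eqP|->].
Qed.

Definition supported U (x0 : 'S_n) w := forall x, x \notin fiber U x0 -> w x = 0.

Lemma fiber_tperm U (x0 : 'S_n) a b x : a \notin U -> b \notin U ->
  ((tperm a b * x)%g \in fiber U x0) = (x \in fiber U x0).
Proof.
move=> aU bU; have tU i : i \in U -> tperm a b i = i.
  by move=> iU; rewrite tpermD //; [apply: contraNneq aU|apply: contraNneq bU] => ->.
by apply/fiberP/fiberP => h i iU; have := h i iU; rewrite permM tU.
Qed.

(** If f and its translates by transpositions that fix U pointwise pair equally with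
    w, then f may be replaced by its average over all permutations that fix U,
    which is constant on the fiber; and w has total sum 0. *)
Lemma orth_swaps k U (x0 : 'S_n) f :
    (forall a b w, a \notin U -> b \notin U -> a != b ->
       supported U x0 w -> null k w ->
       \sum_x f x * w x = \sum_x f (tperm a b * x)%g * w x) ->
  forall w, supported U x0 w -> null k w -> \sum_x f x * w x = 0.
Proof.
move=> swap.
have stab d (s : 'S_n) w : (#|[set i | s i != i]| <= d)%N ->
    (forall i, i \in U -> s i = i) -> supported U x0 w -> null k w ->
    \sum_x f x * w x = \sum_x f (s * x)%g * w x.
  elim: d s w => [|d IH] s w.
    rewrite leqn0 cards_eq0 => /eqP e _ _ _.
    suff -> : s = 1%g by apply: eq_bigr => x _; rewrite mul1g.
    apply/permP => i; rewrite perm1; apply/eqP; apply/negPn/negP => h.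
    by have := in_set0 i; rewrite -e inE h.
  move=> le sU supp nw.
  have [->|s1] := eqVneq s 1%g; first by apply: eq_bigr => x _; rewrite mul1g.
  have [a ha] : exists a, s a != a.
    apply/existsP; apply: contraNT s1 => /existsPn h; apply/eqP/permP => i.
    by rewrite perm1; apply/eqP; have := h i; rewrite negbK.
  pose b := s a.
  have aU : a \notin U by apply: contraNN ha => /sU ->.
  have sb : s b != b by apply: contraNneq ha => e; apply/eqP/(@perm_inj _ s).
  have bU : b \notin U by apply: contraNN sb => /sU ->.
  have ab : a != b by rewrite eq_sym.
  pose s' := (s * tperm a b)%g.
  have tt x : (tperm a b * (tperm a b * x))%g = x by rewrite mulgA tperm2 mul1g.
  have -> : \sum_x f (s * x)%g * w x = \sum_x f (s' * x)%g * w (tperm a b * x)%g.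
    rewrite [RHS](reindex_inj (mulgI (tperm a b))) /=; apply: eq_bigr => x _.
    by rewrite tt /s' -mulgA tt.
  rewrite -IH.
  - rewrite (swap a b w) // [RHS](reindex_inj (mulgI (tperm a b))) /=.
    by apply: eq_bigr => x _; rewrite tt.
  - have lt : [set i | s' i != i] \proper [set i | s i != i].
      apply/properP; split; last by exists a; rewrite !inE // permM tpermR eqxx.
      apply/subsetP => i; rewrite !inE; apply: contraNN => /eqP si.
      rewrite permM si tpermD //; first by apply: contraNneq ha => ->; rewrite si.
      by apply: contraNneq sb => ->; rewrite si.
    by have := leq_trans (proper_card lt) le.
  - move=> i iU; rewrite permM sU // tpermD //.
      by apply: contraNneq aU => ->.
    by apply: contraNneq bU => ->.
  - by move=> x; rewrite -(fiber_tperm x0 _ aU bU); apply: supp.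
  exact: null_mul.
move=> w supp nw.
pose S := [set s : 'S_n | [forall i in U, s i == i]].
have SU s : s \in S -> forall i, i \in U -> s i = i.
  by rewrite inE => /forall_inP h i /h /eqP.
have S1 : 1%g \in S by rewrite inE; apply/forall_inP => i _; rewrite perm1.
have e : #|S|%:R * \sum_x f x * w x = \sum_(y in fiber U x0) f y * \sum_x w x.
  rewrite mulr_natl -sumr_const.
  rewrite (eq_bigr (fun s => \sum_x f (s * x)%g * w x)); last first.
    move=> s /SU sU; apply: (stab n) => //.
    by rewrite -[leqRHS]card_ord max_card.
  rewrite exchange_big /= -mulr_suml mulr_sumr; apply: eq_bigr => x _.
  rewrite -mulr_suml; have [xC|xC] := boolP (x \in fiber U x0); last first.
    by rewrite supp // !mulr0.
  congr (_ * _); rewrite [RHS](reindex_inj (mulIg x)) /=; apply: eq_bigl => s.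
  rewrite inE; apply/forall_inP/fiberP => h i iU.
    by rewrite permM (eqP (h i iU)); apply: (fiberP _ _ _ xC).
  have := h i iU; rewrite permM -(fiberP _ _ _ xC i iU) => /perm_inj ->.
  by rewrite eqxx.
move: e; rewrite (sum0_null nw) [RHS]big1; last by move=> y _; rewrite mulr0.
move/eqP; rewrite mulf_eq0 pnatr_eq0 => /orP[|/eqP //].
by rewrite cards_eq0 => /eqP e; rewrite e inE in S1.
Qed.

(** By [orth_swaps] it suffices to treat h(x) = f(x) - f(tau x) for one transposition
    tau of a and b. Once the values at a and b are fixed, h is killed by cubes with
    one factor less. Fixing these two values costs two pairs of the matchings,
    which is why the order is 2t rather than t. *)
Lemma orth_fiber t U (x0 : 'S_n) f :
    (forall l x, x \in fiber U x0 -> uniq (ends l) -> size l = t.+1 ->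
       (forall i, i \in ends l -> i \notin U) -> diff f l x = 0) ->
  forall w, supported U x0 w -> null t.*2 w -> \sum_x f x * w x = 0.
Proof.
elim: t U x0 f => [|t IH] U x0 f kill; apply: orth_swaps => a b w aU bU ab supp nw.
  apply: eq_bigr => x _; have [xC|xC] := boolP (x \in fiber U x0); last first.
    by rewrite supp // !mulr0.
  congr (_ * _); apply/eqP; rewrite -subr_eq0; apply/eqP.
  apply: (kill [:: (a, b)] x xC) => //=; first by rewrite inE ab.
  by move=> i; rewrite !inE => /orP[] /eqP ->.
apply/eqP; rewrite -subr_eq0 -sumrB; apply/eqP.
(* Split w according to the values c and d at a and b. *)
pose m c d : {set 'I_n * 'I_n} := [set (a, c); (b, d)].
have mP c d x : contains (m c d) x = (c == x a) && (d == x b).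
  apply/containsP/andP => [h|[/eqP -> /eqP ->] i j].
    by rewrite -(h a c) ?inE ?eqxx // -(h b d) ?inE ?eqxx ?orbT.
  by rewrite !inE => /orP[] /eqP[-> ->].
have split_w x : w x = \sum_c \sum_d (contains (m c d) x)%:R * w x.
  rewrite (bigD1 (x a)) //= (bigD1 (x b)) //= mP !eqxx mul1r.
  rewrite !big1 ?addr0 // => c hc; last by rewrite mP (negbTE hc) andbF mul0r.
  by apply: big1 => d _; rewrite mP (negbTE hc) mul0r.
rewrite (eq_bigr (fun x => \sum_c \sum_d
    (f x - f (tperm a b * x)%g) * ((contains (m c d) x)%:R * w x))); last first.
  move=> x _; rewrite -mulrBl [in LHS]split_w mulr_sumr; apply: eq_bigr => c _.
  by rewrite mulr_sumr.
rewrite exchange_big big1 // => c _; rewrite exchange_big big1 // => d _.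
have [/existsP[y /andP[yC yab]]|/existsPn none] :=
    boolP [exists y, (y \in fiber U x0) && contains (m c d) y]; last first.
  apply: big1 => x _; have := none x; rewrite negb_and.
  by case/orP=> [/supp ->|/negbTE ->]; rewrite ?mulr0 // mul0r mulr0.
have fibE x : x \in fiber (a |: (b |: U)) y -> x \in fiber U x0.
  move/fiberP=> h; apply/fiberP => i iU.
  by rewrite h ?inE ?iU ?orbT // (fiberP _ _ _ yC).
apply: (IH (a |: (b |: U)) y).
- move=> l x xC ul sz lU.
  have ulab : uniq (ends ((a, b) :: l)).
    rewrite /= inE negb_or ab ul andbT; apply/andP; split; apply/negP => /lU.
      by rewrite !inE eqxx.
    by rewrite !inE eqxx orbT.
  rewrite diffB diff_shift //; apply: (kill ((a, b) :: l) x) => //.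
  + exact: fibE.
  + by rewrite /= sz.
  move=> i; rewrite /= !inE => /or3P[/eqP -> //|/eqP -> //|/lU].
  by rewrite !inE !negb_or => /and3P[].
- move=> x xC; have [xU|/supp ->] := boolP (x \in fiber U x0); last by rewrite mulr0.
  have [|_] := boolP (contains (m c d) x); last by rewrite mul0r.
  rewrite mP => /andP[/eqP xa /eqP xb]; case/negP: xC; apply/fiberP => i.
  move: yab; rewrite mP => /andP[/eqP ya /eqP yb].
  rewrite !inE => /or3P[/eqP ->|/eqP ->|iU]; rewrite -?xa -?xb //.
  by rewrite (fiberP _ _ _ xU) // (fiberP _ _ _ yC).
apply: null_restrict; apply: nullW nw.
by rewrite cards2 doubleS; case: (_ != _); lia.
Qed.

Lemma orth_cubes t f :
    (forall l x, uniq (ends l) -> size l = t.+1 -> diff f l x = 0) ->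
  forall w, null t.*2 w -> \sum_x f x * w x = 0.
Proof.
move=> kill w nw; apply: (orth_fiber (U := set0) (x0 := 1%g)) nw => [l x _ ul sz _|x].
  exact: kill.
by case/negP; apply/fiberP => i; rewrite inE.
Qed.

End Orthogonality.

Lemma sum_enum_val (T : finType) (F : T -> rat) :
  \sum_(c < #|T|) F (enum_val c) = \sum_x F x.
Proof. by rewrite -big_enum_val. Qed.

(** Finite-dimensional duality: a vector that is annihilated by every functional
    vanishing on the r i is a combination of them. *)
Lemma span_duality (I T : finType) (r : I -> T -> rat) (w : T -> rat) :
    (forall f : T -> rat, (forall i, \sum_x r i x * f x = 0) ->
       \sum_x w x * f x = 0) ->
  exists a : I -> rat, forall x, w x = \sum_i a i * r i x.
Proof.
move=> dual.
pose M : 'M[rat]_(#|I|, #|T|) := \matrix_(i, c) r (enum_val i) (enum_val c).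
pose v : 'rV[rat]_#|T| := \row_c w (enum_val c).
have /submxP[D vD] : (v <= M)%MS.
  rewrite submxE; apply/eqP/matrixP => i j; rewrite !mxE.
  pose f x := cokermx M (enum_rank x) j.
  rewrite -[RHS](dual f); last first.
    move=> k; have := congr1 (fun A : 'M_(_, _) => A (enum_rank k) j) (mulmx_coker M).
    rewrite !mxE => e; rewrite -[RHS]e -sum_enum_val; apply: eq_bigr => c _.
    by rewrite [M _ _]mxE /f enum_valK enum_rankK.
  rewrite -(sum_enum_val (fun x => w x * f x)); apply: eq_bigr => c _.
  by rewrite [v _ _]mxE /f enum_valK.
exists (fun i => D 0 (enum_rank i)) => x.
have := congr1 (fun A : 'M_(_, _) => A 0 (enum_rank x)) vD.
rewrite !mxE enum_rankK => ->; rewrite -(sum_enum_val (fun i => D 0 (enum_rank i) * r i x)); apply: eq_bigr => c _.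
by rewrite ?mxE enum_valK enum_rankK.
Qed.

Definition cube_at n t (i : t.+1.-tuple ('I_n * 'I_n) * 'S_n) (x : 'S_n) : rat :=
  if uniq (ends i.1) then cube i.1 i.2 x else 0.

Lemma null_cube_at n t (i : t.+1.-tuple ('I_n * 'I_n) * 'S_n) : null t (cube_at i).
Proof.
have [u|/negbTE u] := boolP (uniq (ends i.1)).
  apply: (@eq_null _ _ (cube i.1 i.2)) => [x|]; first by rewrite /cube_at u.
  by apply: (cube_null _ u); rewrite size_tuple.
by apply: eq_null (@null0 _ _) => x; rewrite /cube_at u.
Qed.

Lemma null_span_cubes n t (w : 'S_n -> rat) : null t.*2 w ->
  exists a : t.+1.-tuple ('I_n * 'I_n) * 'S_n -> rat,
    forall x, w x = \sum_i a i * cube_at i x.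
Proof.
move=> nw; apply: span_duality => f hf.
rewrite (eq_bigr (fun x => f x * w x)); last by move=> x _; rewrite mulrC.
apply: (orth_cubes (t := t)) nw => l x ul sz.
have szb : size l == t.+1 by rewrite sz.
have := hf (Tuple szb, x); rewrite -sum_cube => e; rewrite -[RHS]e; apply: eq_bigr => y _.
by rewrite /cube_at /= ul.
Qed.

(** * Integral rounding modulo cubes *)

Lemma short_span (I T : finType) (r : I -> T -> rat) :
  exists J : {set I}, (#|J| <= #|T|)%N /\
    forall w : T -> rat, (exists a : I -> rat, forall x, w x = \sum_i a i * r i x) ->
    exists a : I -> rat, forall x, w x = \sum_(i in J) a i * r i x.
Proof.
pose M : 'M[rat]_(#|I|, #|T|) := \matrix_(i, c) r (enum_val i) (enum_val c).
pose g := maxrankfun M.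
exists [set enum_val (g k) | k in 'I_(\rank M)]; split.
  apply: leq_trans (leq_imset_card _ _) _; rewrite card_ord; exact: rank_leq_col.
move=> w [a ha].
have /submxP[D vD] : (\row_c w (enum_val c) <= rowsub g M)%MS.
  rewrite (eq_maxrowsub M); apply/submxP; exists (\row_i a (enum_val i)).
  apply/matrixP => i j; rewrite !mxE ha -(sum_enum_val (fun i => a i * r i _)); apply: eq_bigr => c _.
  by rewrite !mxE.
have ig : injective (fun k => enum_val (g k)).
  by move=> k k' /enum_val_inj/maxrankfun_inj.
exists (fun i => \sum_(k | enum_val (g k) == i) D 0 k) => x.
rewrite big_imset /=; last by move=> k k' _ _ /ig.
have := congr1 (fun A : 'M_(_, _) => A 0 (enum_rank x)) vD.
rewrite !mxE enum_rankK => ->; apply: eq_bigr => k _.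
rewrite !mxE enum_rankK (big_pred1 k) // => k' /=.
by apply/eqP/eqP => [/ig|->].
Qed.

(** Replacing the coefficients of u - c in a basis taken from the vectors r i by
    their fractional parts leaves, besides c, at most #|T| short vectors. *)
Lemma round_mod_span (I T : finType) (r : I -> T -> rat) (u c : T -> rat) (N : nat) :
    (forall i x, r i x \is a Num.int) -> (forall i x, `|r i x| <= N%:R) ->
    (forall x, u x \is a Num.int) ->
    (exists a : I -> rat, forall x, u x - c x = \sum_i a i * r i x) ->
  exists z : I -> rat, let v x := u x - \sum_i z i * r i x in
    (forall i, z i \is a Num.int) /\
    (forall x, v x \is a Num.int /\ `|v x| <= `|c x| + (#|T| * N)%:R).
Proof.
move=> ri rN ui hex; have [J [cJ hJ]] := short_span r.
have [a ha] := hJ (fun x => u x - c x) hex.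
pose z i : rat := if i \in J then (Num.floor (a i))%:~R else 0.
have zi i : z i \is a Num.int by rewrite /z; case: ifP; rewrite ?intr_int ?rpred0.
exists z => /=; split=> // x; split.
  by rewrite rpredB // rpred_sum // => i _; rewrite rpredM.
have -> : u x - \sum_i z i * r i x = c x + \sum_(i in J) (a i - z i) * r i x.
  rewrite (bigID (mem J)) /= [X in _ - (_ + X)]big1 ?addr0; last first.
    by move=> i /negbTE iJ; rewrite /z iJ mul0r.
  under [in RHS]eq_bigr => i _ do rewrite mulrBl.
  by rewrite sumrB -ha; lra.
apply: le_trans (ler_normD _ _) _; rewrite lerD2l.
apply: le_trans (ler_norm_sum _ _ _) _.
apply: (@le_trans _ _ (\sum_(i in J) N%:R)); last first.
  by rewrite sumr_const -mulrnA ler_nat mulnC leq_mul2r cJ orbT.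
apply: ler_sum => i iJ; rewrite normrM -[leRHS]mul1r.
apply: ler_pM => //; rewrite /z iJ.
have := floor_itv (a i); rewrite intrD => /andP[h1 h2].
by rewrite ger0_norm; lra.
Qed.

Lemma cube_int n l (x y : 'S_n) : cube l x y \is a Num.int.
Proof.
elim: l x => [|p l IH] x; first by rewrite ffunE rpred_nat.
by rewrite /cube diff_cons !ffunE rpredB //; apply: IH.
Qed.

Lemma cube_mass n l (x : 'S_n) : \sum_y `|cube l x y| <= (2 ^ size l)%:R.
Proof.
elim: l x => [|p l IH] x.
  rewrite (bigD1 x) //= big1 ?addr0 => [|y ne]; rewrite ffunE ?eqxx ?normr1 //.
  by rewrite (negbTE ne) normr0.
rewrite /= expnS mul2n -addnn natrD.
apply: le_trans (lerD (IH x) (IH (tperm p.1 p.2 * x)%g)).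
rewrite -big_split; apply: ler_sum => y _.
by rewrite {1}/cube diff_cons !ffunE; apply: ler_normB.
Qed.

(** Every element is first rewritten in the generators by [decode], where cubes with
    t + 1 factors become relations with entries bounded by n^O(t); then
    [round_mod_span] applies to these relations. *)
Lemma integral_correction n t (D c : 'S_n -> rat) :
    (forall x, D x \is a Num.int) -> null t.*2 (fun x => D x - c x) ->
  exists E : 'S_n -> rat, [/\ forall y, y \notin generators n t -> E y = 0,
    forall y, E y \is a Num.int,
    forall y, `|E y| <= (\sum_x `|c x|) * (delta_cost n t)%:R
                        + (#|generators n t| * (2 ^ t.+1 * delta_cost n t))%:R &
    null t (fun x => D x - E x)].
Proof.
move=> Di nDc; have [dec hdec] := decode n t.
have dec0 x y : y \notin generators n t -> dec x y = 0.
  by have [h _ _ _] := hdec x; apply: h.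
have deci x y : dec x y \is a Num.int by have [_ h _ _] := hdec x.
have decA x y : `|dec x y| <= (delta_cost n t)%:R.
  have [_ _ h _] := hdec x; apply: le_trans h; rewrite (bigD1 y) //= lerDl.
  exact: sumr_ge0.
have decn x : null t (fun y => delta x y - dec x y) by have [] := hdec x.
pose ext (u : 'S_n -> rat) y := \sum_x u x * dec x y.
have ext_null u : null t (fun y => u y - ext u y).
  apply: (@eq_null _ _ (fun y => \sum_x u x * (delta x y - dec x y))) => [y|].
    under eq_bigr => x _ do rewrite mulrBr.
    rewrite sumrB; congr (_ - _); rewrite (bigD1 y) //= ffunE eqxx mulr1.
    by rewrite big1 ?addr0 // => x ne; rewrite ffunE eq_sym (negbTE ne) mulr0.
  by apply: null_sum => x _; apply: nullZ.
have ext_mass u y : `|ext u y| <= (\sum_x `|u x|) * (delta_cost n t)%:R.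
  apply: le_trans (ler_norm_sum _ _ _) _; rewrite mulr_suml; apply: ler_sum => x _.
  by rewrite normrM ler_wpM2l.
pose T := {y : 'S_n | y \in generators n t}.
pose r (i : t.+1.-tuple ('I_n * 'I_n) * 'S_n) (y : T) := ext (cube_at i) (val y).
have cube_at_int i x : cube_at i x \is a Num.int.
  by rewrite /cube_at; case: ifP => _; rewrite ?cube_int ?rpred0.
have [z [zi hv]] : exists z : t.+1.-tuple ('I_n * 'I_n) * 'S_n -> rat,
   let v y := ext D (val y) - \sum_i z i * r i y in
   (forall i, z i \is a Num.int) /\ forall y : T, v y \is a Num.int /\
     `|v y| <= `|ext c (val y)| + (#|{: T}| * (2 ^ t.+1 * delta_cost n t))%:R.
  apply: (round_mod_span (r := r) (c := fun y => ext c (val y))).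
  - by move=> i y; apply: rpred_sum => x _; rewrite rpredM.
  - move=> i y; apply: le_trans (ext_mass _ _) _; rewrite natrM ler_wpM2r //.
    rewrite /cube_at; case: (uniq (ends i.1)); last by rewrite big1 // => x _; rewrite normr0.
    by apply: le_trans (cube_mass _ _) _; rewrite size_tuple.
  - by move=> y; apply: rpred_sum => x _; rewrite rpredM.
  have [a ha] := null_span_cubes nDc; exists a => y; rewrite -sumrB.
  under eq_bigr => x _ do rewrite -mulrBl ha mulr_suml.
  rewrite exchange_big; apply: eq_bigr => i _ /=; rewrite mulr_sumr.
  by apply: eq_bigr => x _; rewrite mulrA.
exists (fun y => ext D y - \sum_i z i * ext (cube_at i) y).
have off y : y \notin generators n t -> ext D y - \sum_i z i * ext (cube_at i) y = 0.
  have ext0 u : y \notin generators n t -> ext u y = 0.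
    by move=> yB; apply: big1 => x _; rewrite dec0 ?mulr0.
  move=> yB; rewrite ext0 // big1 ?subrr // => i _; by rewrite ext0 ?mulr0.
split=> // [y|y|].
- have [yB|/off ->] := boolP (y \in generators n t); last exact: rpred0.
  by have [] := hv (exist _ y yB).
- have [yB|/off ->] := boolP (y \in generators n t); last first.
    by rewrite normr0 addr_ge0 // mulr_ge0 // sumr_ge0.
  have [_ h] := hv (exist _ y yB); apply: le_trans h _ => /=.
  by rewrite card_sig /= lerD2r; apply: ext_mass.
apply: (@eq_null _ _ (fun y => (D y - ext D y) +
   (\sum_i z i * cube_at i y - \sum_i z i * (cube_at i y - ext (cube_at i) y)))).
  move=> y; under [X in _ + (_ - X)]eq_bigr => i _ do rewrite mulrBr.
  by rewrite sumrB; lra.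
apply: nullD => //; apply: nullB; apply: null_sum => i _; apply: nullZ => //.
exact: null_cube_at.
Qed.

(** * From fractional to integral sets *)

Lemma kernel_direction (T C : finType) (r : T -> C -> rat) (Fr : {set T}) :
    (#|C| < #|Fr|)%N ->
  exists w : T -> rat, [/\ exists x, w x != 0, forall x, x \notin Fr -> w x = 0 &
    forall c, \sum_x w x * r x c = 0].
Proof.
move=> lt.
pose M : 'M[rat]_(#|Fr|, #|C|) := \matrix_(i, j) r (enum_val i) (enum_val j).
have : kermx M != 0.
  rewrite kermx_eq0 /row_free neq_ltn; apply/orP; left.
  exact: leq_ltn_trans (rank_leq_col M) lt.
case/rowV0Pn => v /sub_kermxP vM v0.
exists (fun x => \sum_(i | enum_val i == x) v 0 i); split.
- have [j vj] : exists j, v 0 j != 0.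
    apply/existsP; apply: contraNT v0 => /existsPn h; apply/eqP/rowP => j.
    by rewrite !mxE; apply/eqP; have := h j; rewrite negbK.
  exists (enum_val j); rewrite (big_pred1 j) // => i /=.
  by apply/eqP/eqP => [/enum_val_inj|->].
- move=> x xF; apply: big_pred0 => i; apply: contraNF xF => /eqP <-.
  exact: enum_valP.
move=> c; have := congr1 (fun A : 'M_(_, _) => A 0 (enum_rank c)) vM.
rewrite !mxE => e; rewrite -[RHS]e.
under eq_bigr => x _ do rewrite mulr_suml.
rewrite (exchange_big_dep xpredT) //=; apply: eq_bigr => i _.
by rewrite (big_pred1 (enum_val i)) ?mxE ?enum_rankK // => x /=; rewrite eq_sym.
Qed.

Definition fractional (T : finType) (eta : T -> rat) : {set T} := [set x | 0 < eta x < 1].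

(** A basic solution of a linear program: as long as there are more fractional
    entries than constraints, some direction supported on them preserves all
    constraints, and moving along it until the first entry reaches 0 or 1 makes
    progress. *)
Lemma vertex_rounding (T C : finType) (r : T -> C -> rat) (eta : T -> rat) :
    (forall x, 0 <= eta x <= 1) ->
  exists eta' : T -> rat, [/\ forall x, 0 <= eta' x <= 1,
    forall x, eta x = 0 -> eta' x = 0, (#|fractional eta'| <= #|C|)%N &
    forall c, \sum_x eta' x * r x c = \sum_x eta x * r x c].
Proof.
have [d] := ubnP #|fractional eta|; elim: d eta => // d IH eta led h01.
have [le|lt] := leqP #|fractional eta| #|C|; first by exists eta.
have [w [[x0 wx0] w0 wr]] := kernel_direction r lt.
have Fw x : w x != 0 -> 0 < eta x < 1.
  by apply: contraNT => h; rewrite w0 ?inE.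
(* The time at which the entry x reaches 0 or 1 when moving along w. *)
pose step x := if 0 < w x then (1 - eta x) / w x else eta x / - w x.
have [x1 wx1 min1] := @arg_minP _ _ _ x0 (fun x => w x != 0) step wx0.
set al := step x1 in min1.
have al0 : 0 < al.
  have /andP[h1 h2] := Fw x1 wx1.
  rewrite /al /step; case: (ltP 0 (w x1)) => hw; rewrite divr_gt0 ?subr_gt0 // oppr_gt0.
  by rewrite lt_neqAle wx1.
pose eta1 x := eta x + al * w x.
have in01 x : 0 <= eta1 x <= 1.
  have [wx|wx] := eqVneq (w x) 0; first by rewrite /eta1 wx mulr0 addr0.
  have := min1 x wx; have /andP[h1 h2] := Fw x wx; rewrite /eta1 [step x]/step.
  case: (ltP 0 (w x)) => hw.
    rewrite ler_pdivlMr // => h; have : 0 < al * w x by rewrite mulr_gt0.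
    lra.
  have hw' : 0 < - w x by rewrite oppr_gt0 lt_neqAle wx.
  rewrite ler_pdivlMr // mulrN => h; have : 0 < al * - w x by rewrite mulr_gt0.
  rewrite mulrN; lra.
have x1frac : x1 \notin fractional eta1.
  rewrite inE /eta1 /al /step; case: (ltP 0 (w x1)) => hw.
    by rewrite divfK // addrC subrK ltxx andbF.
  by rewrite invrN mulrN mulNr divfK // subrr ltxx.
have sub : fractional eta1 \proper fractional eta.
  apply/properP; split; last by exists x1; rewrite // inE; apply: Fw.
  apply/subsetP => x; have [wx|wx] := eqVneq (w x) 0.
    by rewrite !inE /eta1 wx mulr0 addr0.
  by move=> _; rewrite inE; apply: Fw.
have lt1 : (#|fractional eta1| < d)%N by apply: leq_trans (proper_card sub) _.
have [eta' [h1 h2 h3 h4]] := IH eta1 lt1 in01.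
exists eta'; split=> // [x ex|c].
  apply: h2; rewrite /eta1 ex add0r w0 ?mulr0 // inE ex ltxx //.
rewrite h4; under eq_bigr => x _ do rewrite mulrDl -mulrA.
by rewrite big_split /= -mulr_sumr wr mulr0 addr0.
Qed.

(** Indexing the sets of at most k elements by k-tuples bounds the number of
    statistics of order k by (n^2 + 1)^k. *)
Lemma set_of_options (T : finType) k (m : {set T}) : (#|m| <= k)%N ->
  exists q : k.-tuple (option T), [set p | Some p \in q] = m.
Proof.
move=> le; have sz : size (map Some (enum m) ++ nseq (k - #|m|) None) == k.
  by rewrite size_cat size_map size_nseq -cardE subnKC.
exists (Tuple sz); apply/setP => p; rewrite inE memtE /= mem_cat.
rewrite mem_map ?mem_enum; last by move=> ? ? [].
by rewrite mem_nseq andbF orbF.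
Qed.

Lemma round_to_set n k (eta : 'S_n -> rat) : (forall x, 0 <= eta x <= 1) ->
  exists (F : {set 'S_n}) (c : 'S_n -> rat),
    [/\ forall x, eta x = 0 -> x \notin F,
        \sum_x `|c x| <= ((n * n).+1 ^ k)%:R &
        null k (fun x => eta x - ind F x - c x)].
Proof.
move=> h01.
pose r (x : 'S_n) (q : k.-tuple (option ('I_n * 'I_n))) : rat :=
  (contains [set p | Some p \in q] x)%:R.
have [eta' [h1 h2 h3 h4]] := vertex_rounding r h01.
exists [set x | eta' x == 1], (fun x => if x \in fractional eta' then eta' x else 0); split.
- by move=> x /h2; rewrite inE => ->; rewrite eq_sym oner_eq0.
- apply: (@le_trans _ _ #|fractional eta'|%:R); last first.
    rewrite ler_nat; apply: leq_trans h3 _.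
    by rewrite card_tuple card_option card_prod card_ord.
  rewrite -sum1_card natr_sum [leRHS]big_mkcond; apply: ler_sum => x _.
  case: ifP => _; rewrite ?normr0 //; have /andP[? ?] := h1 x.
  by rewrite ger0_norm.
apply: (@eq_null _ _ (fun x => eta x - eta' x)) => [x|m cm].
  rewrite !ffunE !inE; have /andP[ge0 le1] := h1 x.
  have [->|n1] := eqVneq (eta' x) 1; first by rewrite ltxx andbF subr0.
  have [->|n0] := eqVneq (eta' x) 0; first by rewrite ltxx !subr0.
  by rewrite !lt_neqAle ge0 le1 n1 eq_sym n0 /= subr0.
have [q <-] := set_of_options cm.
rewrite statB !statE; have := h4 q; rewrite /r => e.
rewrite (eq_bigr (fun x => eta x * (contains [set p | Some p \in q] x)%:R)); last first.
  by move=> x _; rewrite mulrC.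
by rewrite -e -sumrB big1 // => x _; rewrite mulrC subrr.
Qed.

(** * A signed integral design *)

Section Cells.
Variable n : nat.
Implicit Types (m : {set 'I_n * 'I_n}) (e w : 'S_n -> rat) (Z : {set 'I_n}).

Definition sources m := [set p.1 | p in m].

Lemma mem_sources m i j : (i, j) \in m -> i \in sources m.
Proof. by move=> ij; apply/imsetP; exists (i, j). Qed.

Lemma sourcesP m i : i \in sources m -> exists j, (i, j) \in m.
Proof. by case/imsetP=> -[i' j] ij ->; exists j. Qed.

Lemma stat_split m j e : stat m e = \sum_i stat ((i, j) |: m) e.
Proof.
rewrite statE; under [RHS]eq_bigr => i _ do rewrite statE.
rewrite exchange_big; apply: eq_bigr => x _; rewrite -mulr_suml; congr (_ * _).
rewrite (bigD1 ((x^-1)%g j)) //= big1 ?addr0 => [|i ne].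
  congr (nat_of_bool _)%:R; apply/containsP/containsP => h i j'.
    by rewrite inE => /orP[|/h //]; rewrite inE => /eqP[-> ->]; rewrite permKV.
  by move=> ij; apply: h; rewrite inE ij orbT.
apply/eqP; rewrite pnatr_eq0 eqb0; apply/containsP => h; case/eqP: ne.
by rewrite -(h i j) ?permK // !inE eqxx.
Qed.

Lemma stat_conflict m i j j' e : (i, j) \in m -> (i, j') \in m -> j != j' ->
  stat m e = 0.
Proof.
move=> h h' ne; apply: big_pred0 => x; apply/containsP => c; case/eqP: ne.
by rewrite -(c _ _ h) -(c _ _ h').
Qed.

(** Induction on the number of pairs (z, j) of m with z in Z. Summing over the
    possible preimages of j expresses the statistic of m without (z, j) through
    those of (i, j) added to it. The ones with i outside Z meet Z less often and
    vanish by induction; those with i in Z are all equal by invariance, hence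
    they vanish as well. *)
Lemma null_of_avoiding k Z Z' e :
    {in Z &, forall z z' x, e (tperm z z' * x)%g = e x} ->
    (forall m, (#|m| <= k)%N -> (forall p, p \in m -> p.1 \notin Z) ->
       (forall p, p \in m -> p.2 \notin Z') -> stat m e = 0) ->
  forall m, (#|m| <= k)%N -> (forall p, p \in m -> p.2 \notin Z') -> stat m e = 0.
Proof.
move=> inv h0 m; have [d] := ubnP #|[set p in m | p.1 \in Z]|.
elim: d m => // d IH m; rewrite ltnS => led mk mZ'.
have [/existsP[[z j] /= /andP[zj zZ]]|/existsPn none] :=
    boolP [exists p, (p \in m) && (p.1 \in Z)]; last first.
  by apply: h0 => // p pm; have := none p; rewrite pm.
pose m' := m :\ (z, j).
have mE : (z, j) |: m' = m by rewrite setD1K.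
have sub' p : p \in m' -> p \in m by rewrite inE => /andP[].
have m'k : (#|m'| < k)%N.
  by apply: leq_trans mk; rewrite [X in (_ < X)%N](cardsD1 (z, j)) zj.
have m't i : i \notin Z ->
    (#|[set p in (i, j) |: m' | p.1 \in Z]| < d)%N.
  move=> iZ; apply: leq_trans led.
  rewrite [X in (_ < X)%N](cardsD1 (z, j)) inE zj zZ /= add1n ltnS.
  apply: subset_leq_card; apply/subsetP => p; rewrite !inE.
  case/andP=> /orP[/eqP ->|/andP[-> ->] ->] //=; by rewrite (negbTE iZ).
have m't' : (#|[set p in m' | p.1 \in Z]| < d)%N.
  apply: leq_trans led.
  rewrite [X in (_ < X)%N](cardsD1 (z, j)) inE zj zZ /= add1n ltnS.
  by apply: subset_leq_card; apply/subsetP => p; rewrite !inE => /andP[/andP[-> ->] ->].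
have jZ' : j \notin Z' by apply: (mZ' (z, j)).
have ext_ok i : (#|(i, j) |: m'| <= k)%N /\ forall p, p \in (i, j) |: m' -> p.2 \notin Z'.
  split; first by rewrite cardsU1; case: (_ \notin _); rewrite /= ?add1n ?add0n // ltnW.
  by move=> p; rewrite !inE => /orP[/eqP -> //|/andP[_ /mZ']].
(* If m matches z twice, no permutation contains it. *)
have [/sourcesP[j' zj']|zm'] := boolP (z \in sources m').
  apply: (@stat_conflict m z j j') => //; first exact: sub'.
  by move: zj'; rewrite !inE xpair_eqE eqxx /= eq_sym => /andP[].
have := stat_split m' j e.
rewrite [LHS]IH //; [|exact: ltnW|by move=> p /sub'/mZ'].
rewrite (bigID (fun i => (i \in Z) && (i \notin sources m'))) /= [X in _ + X]big1 ?addr0.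
  rewrite (eq_bigr (fun _ => stat m e)) => [|i /andP[iZ im']].
    rewrite sumr_const => /esym/eqP; rewrite mulrn_eq0 => /orP[|/eqP //].
    by move/eqP/card0_eq/(_ z); rewrite unfold_in zZ zm' inE.
  transitivity (stat ((z, j) |: m') e); last by rewrite mE.
  rewrite -(eq_stat _ (inv _ _ zZ iZ)) stat_mul; congr (stat _ _).
  rewrite tpermV imsetU1 /= tpermR; congr (_ |: _).
  rewrite -[RHS]imset_id; apply: eq_in_imset => -[a b] ab /=.
  by rewrite tpermD //; [apply: contraNneq zm'|apply: contraNneq im'] => ->; apply: mem_sources ab.
move=> i; rewrite negb_and negbK; have [e1 e2] := ext_ok i.
have [iZ /= /sourcesP[j' ij']|iZ _] := boolP (i \in Z); last by apply: IH => //; apply: m't.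
have [ej|ne] := eqVneq j j'; last first.
  by apply: (@stat_conflict _ i j j') => //; rewrite ?in_setU1 ?eqxx // ij' orbT.
by rewrite [_ |: _](setUidPr _) ?sub1set ?ej //; apply: IH => //; [exact: ltnW|move=> p /sub'/mZ'].
Qed.

Lemma stat_inv m e : stat m (fun x => e (x^-1)%g) = stat [set (p.2, p.1) | p in m] e.
Proof.
rewrite /stat [RHS](reindex_inj invg_inj) /=; apply: eq_bigl => x.
apply/containsP/containsP => h i j.
  by case/imsetP=> -[i' j'] /h <- [-> ->]; rewrite permK.
move=> ij; rewrite -(h j i) ?permKV //; by apply/imsetP; exists (i, j).
Qed.

(** An invariant function on both sides under the permutations of Z is determined
    by the matchings that avoid Z; two applications of [null_of_avoiding], the
    second one to the function composed with inversion. *)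
Lemma null_of_invariant k Z e :
    {in Z &, forall z z' x, e (tperm z z' * x)%g = e x} ->
    {in Z &, forall z z' x, e (x * tperm z z')%g = e x} ->
    (forall m, (#|m| <= k)%N -> (forall p, p \in m -> p.1 \notin Z) ->
       (forall p, p \in m -> p.2 \notin Z) -> stat m e = 0) ->
  null k e.
Proof.
move=> invl invr h0.
have h1 := null_of_avoiding invl h0.
have h2 m : (#|m| <= k)%N -> stat m (fun x => e (x^-1)%g) = 0.
  move=> mk; apply: (@null_of_avoiding k Z set0) mk _; last by move=> p; rewrite inE.
    by move=> z z' zZ z'Z x; rewrite invMg tpermV invr.
  move=> {}m mk mZ _; rewrite stat_inv; apply: h1.
    exact: leq_trans (leq_imset_card _ _) mk.
  by move=> _ /imsetP[p /mZ pZ ->].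
move=> m mk; have := h2 [set (p.2, p.1) | p in m].
rewrite stat_inv -imset_comp /= => h; rewrite -[RHS]h; last first.
  exact: leq_trans (leq_imset_card _ _) mk.
by congr (stat _ _); rewrite -[LHS]imset_id; apply: eq_imset => -[].
Qed.

End Cells.

Section Triangular.
Variable n : nat.
Implicit Types (m : {set 'I_n * 'I_n}) (Z : {set 'I_n}).

Lemma containsE m (x : 'S_n) i j : contains m x -> (i, j) \in m -> x i = j.
Proof. by move/containsP=> h /h. Qed.

Lemma card_sources m (x : 'S_n) : contains m x -> #|sources m| = #|m|.
Proof.
move/containsP=> h; apply: card_in_imset => -[i j] [i' j'] /h <- /h <- /=.
by move=> ->.
Qed.

Lemma stat_one m (x0 : 'S_n) : contains m x0 ->
  stat m (fun _ => 1) = (n - #|m|)`!%:R.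
Proof.
move=> c0; rewrite -(card_sources c0).
have <- : #|~: sources m| = (n - #|sources m|)%N by rewrite cardsCs setCK card_ord.
rewrite -card_perm -sum1_card natr_sum /stat (reindex_inj (mulIg x0)) /=.
apply: eq_bigl => s; apply/containsP/subsetP => [h i|h i j ij].
  rewrite !inE; apply: contra => /sourcesP[j ij]; have := h _ _ ij.
  by rewrite permM -(containsE c0 ij) => /perm_inj ->.
rewrite permM; have [e|ne] := eqVneq (s i) i; first by rewrite e (containsE c0 ij).
by have := h i; rewrite inE => /(_ ne); rewrite inE (mem_sources ij).
Qed.

Definition avoids Z m := [forall p in m, (p.1 \notin Z) && (p.2 \notin Z)].

Lemma avoidsP Z m : reflect
  (forall i j, (i, j) \in m -> i \notin Z /\ j \notin Z) (avoids Z m).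
Proof.
apply: (iffP forall_inP) => [h i j /h /andP //|h [i j] /h [/= -> ->] //].
Qed.

Lemma fixing_extension Z m (x : 'S_n) : contains m x -> avoids Z m ->
  exists2 y : 'S_n, contains m y & forall z, z \in Z -> y z = z.
Proof.
move=> cx /avoidsP av.
suff [y cy h] : exists2 y : 'S_n, contains m y & forall z, z \in enum Z -> y z = z.
  by exists y => // z zZ; apply: h; rewrite mem_enum.
have : {subset enum Z <= Z} by move=> z; rewrite mem_enum.
elim: (enum Z) => [|z s IH] sub; first by exists x.
have [|y /containsP cy h] := IH; first by move=> u us; apply: sub; rewrite inE us orbT.
have zZ : z \in Z by apply: sub; rewrite mem_head.
exists (y * tperm (y z) z)%g.
  apply/containsP => i j ij; rewrite permM (cy _ _ ij) tpermD //.
    have [iZ _] := av _ _ ij; apply: contraNneq iZ => e.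
    by have := cy _ _ ij; rewrite -e => /perm_inj ->.
  by have [_] := av _ _ ij; apply: contraNneq => <-.
move=> u; rewrite inE permM => /orP[/eqP ->|us]; first by rewrite tpermL.
have [->|uz] := eqVneq u z; first by rewrite tpermL.
rewrite (h _ us) tpermD // 1?eq_sym //; rewrite -{1}(h _ us).
by apply: contra uz => /eqP/perm_inj ->.
Qed.

Lemma diff_corner0 (f : 'S_n -> rat) l x : (forall y, y \in corner l x -> f y = 0) ->
  diff f l x = 0.
Proof.
elim: l x => [|p l IH] x h; first by apply: h; rewrite inE.
by rewrite diff_cons !IH ?subrr // => y yc; apply: h; rewrite /= inE yc ?orbT.
Qed.

Lemma diff_corner1 (f : 'S_n -> rat) l (x : 'S_n) : uniq (ends l) ->
    (forall p (y : 'S_n), p \in l -> y p.1 = x p.2 -> f y = 0) ->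
  diff f l x = f x.
Proof.
elim: l => // p l IH; rewrite [ends _]/= [uniq _]/= inE negb_or -andbA => /and4P[_ p1 p2 ul] h.
rewrite diff_cons IH // => [|q y ql]; last by apply: h; rewrite inE ql orbT.
rewrite diff_corner0 ?subr0 // => y yc; apply: (h p); first exact: mem_head.
by rewrite (corner_agree yc p1) permM tpermL.
Qed.

Lemma perm_ends_zip (s1 s2 : seq 'I_n) : size s1 = size s2 ->
  perm_eq (ends (zip s1 s2)) (s1 ++ s2).
Proof.
elim: s1 s2 => [|a s1 IH] [|b s2] //= [sz]; rewrite perm_cons.
rewrite -cat1s -[b :: s2]cat1s perm_sym perm_catCA perm_cat2l perm_sym; exact: IH.
Qed.

(** Transpose each point matched by m with its own point of Z, starting from a
    permutation that contains m and fixes Z pointwise. A transposed point is sent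
    into Z, so only the base of the cube contains a matching that avoids Z. *)
Lemma isolating_cube Z m (x0 : 'S_n) : contains m x0 -> avoids Z m -> (#|m| <= #|Z|)%N ->
  exists C : 'S_n -> rat, (forall x, C x \is a Num.int) /\
    forall m', avoids Z m' -> (#|m'| <= #|m|)%N -> stat m' C = (m' == m)%:R.
Proof.
move=> c0 av mZ; have [x cx fx] := fixing_extension c0 av.
pose s2 := take #|m| (enum Z).
have sz : size (enum (sources m)) = size s2.
  by rewrite size_takel -?cardE ?(card_sources c0).
pose l := zip (enum (sources m)) s2.
have s2Z z : z \in s2 -> z \in Z by move/mem_take; rewrite mem_enum.
have avm := avoidsP _ _ av.
have ul : uniq (ends l).
  rewrite (perm_uniq (perm_ends_zip sz)) cat_uniq enum_uniq take_uniq ?enum_uniq // andbT.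
  apply/hasPn => z /s2Z zZ /=; rewrite mem_enum; apply/negP => /sourcesP[j] /avm[].
  by rewrite zZ.
have lP p : p \in l -> p.1 \in sources m /\ p.2 \in Z.
  move=> pl; split.
    by rewrite -mem_enum -(unzip1_zip (t := s2) (s := enum (sources m))) ?sz //; apply: map_f.
  by apply: s2Z; rewrite -(unzip2_zip (t := s2) (s := enum (sources m))) ?sz //; apply: map_f.
exists (cube l x); split=> [y|m' av' m'm]; first exact: cube_int.
have avm' := avoidsP _ _ av'.
rewrite stat_cube; have [sub|/subsetPn[i im im']] := boolP (sources m \subset sources m').
  have eD : sources m' = sources m.
    apply/esym/eqP; rewrite eqEcard sub (card_sources c0).
    exact: leq_trans (leq_imset_card _ _) m'm.
  rewrite diff_corner1 // => [|p y pl yp]; last first.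
    have [p1 p2] := lP _ pl; apply/eqP; rewrite pnatr_eq0 eqb0; apply/containsP => h.
    have [j pj] : exists j, (p.1, j) \in m' by apply: sourcesP; rewrite eD.
    have [_] := avm' _ _ pj; rewrite -(h _ _ pj) yp fx // => /negP; exact.
  congr (nat_of_bool _)%:R; apply/idP/eqP => [/containsP cx'|-> //].
  apply/setP => -[i j]; apply/idP/idP => ij.
    have [j' ij'] : exists j', (i, j') \in m by apply: sourcesP; rewrite -eD (mem_sources ij).
    by rewrite -(cx' _ _ ij) (containsE cx ij').
  have [j' ij'] : exists j', (i, j') \in m' by apply: sourcesP; rewrite eD (mem_sources ij).
  by rewrite -(containsE cx ij) (cx' _ _ ij').
have [p pl pi] : exists2 p, p \in l & p.1 = i.
  have : i \in unzip1 l by rewrite unzip1_zip ?sz // mem_enum.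
  by case/mapP=> p pl ->; exists p.
rewrite (diff_eq0 _ ul pl) => [|y]; last first.
  rewrite contains_tperm // ?pi //; apply/negP => /sourcesP[j] /avm'[].
  by have [_ ->] := lP _ pl.
by case: eqP im' => // ->; rewrite im.
Qed.

(** The isolating cubes make the system of statistics over the matchings that avoid Z
    triangular with unit diagonal, so it is solvable over the integers. *)
Lemma prescribed_stats Z (v : {set 'I_n * 'I_n} -> rat) k :
    (k <= #|Z|)%N -> (forall m, (#|m| <= k)%N -> v m \is a Num.int) ->
  exists w : 'S_n -> rat, (forall x, w x \is a Num.int) /\
    forall m x, contains m x -> avoids Z m -> (#|m| <= k)%N -> stat m w = v m.
Proof.
move=> kZ vi.
suff: forall s, (s <= k.+1)%N -> exists w : 'S_n -> rat, (forall x, w x \is a Num.int) /\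
    forall m x, contains m x -> avoids Z m -> (#|m| < s)%N -> stat m w = v m.
  by move=> /(_ k.+1 (leqnn _)).
elim=> [|s IH] sk; first by exists (fun _ => 0); split.
have [w [wi wv]] := IH (ltnW sk).
(* The matchings of the current size s, on which w is corrected. *)
pose good m := [&& [exists x, contains m x], avoids Z m & #|m| == s].
have /fin_all_exists[C hC] m : exists C : 'S_n -> rat, good m ->
    (forall x, C x \is a Num.int) /\
    forall m', avoids Z m' -> (#|m'| <= #|m|)%N -> stat m' C = (m' == m)%:R.
  have [/and3P[/existsP[x cx] av /eqP ms]|_] := boolP (good m); last by exists (fun _ => 0).
  have [|C hC] := isolating_cube cx av; last by exists C.
  by rewrite ms; apply: leq_trans kZ.
have si m : stat m w \is a Num.int by apply: rpred_sum.
exists (fun x => w x + \sum_(m | good m) (v m - stat m w) * C m x); split.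
  move=> x; rewrite rpredD // rpred_sum // => m gm; rewrite rpredM //.
    have /and3P[_ _ /eqP ms] := gm; by rewrite rpredB ?vi // ms.
  by have [h _] := hC m gm.
move=> m x cx av; rewrite ltnS statD stat_sum => ms.
rewrite (eq_bigr (fun m' => (v m' - stat m' w) * (m == m')%:R)) => [|m' gm']; last first.
  rewrite statZ; have [_ ->] := hC m' gm' => //.
  by have /and3P[_ _ /eqP ->] := gm'.
have [lt|ge] := ltnP #|m| s.
  rewrite (wv m x) // big1 ?addr0 // => m' /and3P[_ _ /eqP ms'].
  case: eqP => [e|_]; last by rewrite mulr0.
  by rewrite e ms' ltnn in lt.
have gm : good m by rewrite /good av eqn_leq ms ge /= andbT; apply/existsP; exists x.
rewrite (bigD1 m) //= eqxx mulr1 big1 ?addr0; first by rewrite addrC subrK.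
by move=> m' /andP[_ ne]; rewrite eq_sym (negbTE ne) mulr0.
Qed.

Lemma stat_sandwich m (a b : 'S_n) Z w : perm_on Z a -> perm_on Z b -> avoids Z m ->
  stat m (fun x => w (a * x * b)%g) = stat m w.
Proof.
move=> aZ bZ /avoidsP av; rewrite /stat.
rewrite [RHS](reindex_inj (mulIg b)) [RHS](reindex_inj (mulgI a)) /=.
apply: eq_big => [x|x _]; last by [].
apply/containsP/containsP => h i j ij; have [iZ jZ] := av _ _ ij.
  by rewrite !permM (out_perm aZ iZ) (h _ _ ij) (out_perm bZ jZ).
have := h _ _ ij; rewrite !permM (out_perm aZ iZ) -{1}(out_perm bZ jZ).
by move/perm_inj.
Qed.

Lemma perm_onE Z (s : 'S_n) : reflect (forall i, i \notin Z -> s i = i) (perm_on Z s).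
Proof.
apply: (iffP subsetP) => h i; first by move=> iZ; apply: out_perm iZ; apply/subsetP.
by rewrite inE; apply: contraNT => /h ->.
Qed.

Lemma perm_on_tpermM Z z z' (s : 'S_n) : z \in Z -> z' \in Z ->
  (perm_on Z (s * tperm z z')%g = perm_on Z s) *
  (perm_on Z (tperm z z' * s)%g = perm_on Z s).
Proof.
move=> zZ z'Z; have tZ i : i \notin Z -> tperm z z' i = i.
  by move=> iZ; rewrite tpermD //; apply: contraNneq iZ => <-.
have tt (u : 'S_n) : (u * tperm z z' * tperm z z')%g = u by rewrite -mulgA tperm2 mulg1.
have tt' (u : 'S_n) : (tperm z z' * (tperm z z' * u))%g = u by rewrite mulgA tperm2 mul1g.
have r u : perm_on Z u -> perm_on Z (u * tperm z z')%g.
  by move/perm_onE=> h; apply/perm_onE => i iZ; rewrite permM h // tZ.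
have l u : perm_on Z u -> perm_on Z (tperm z z' * u)%g.
  by move/perm_onE=> h; apply/perm_onE => i iZ; rewrite permM tZ // h.
split; apply/idP/idP; [move/r|exact: r|move/l|exact: l]; by rewrite ?tt ?tt'.
Qed.

(** Over the matchings of at most k pairs that avoid a set Z of k points, the
    statistics of the constant function with total n ^_ k are integers, so some
    integer-valued w has them. Summing w over the permutations of Z on both sides
    multiplies these statistics by k!^2 and makes the function invariant; the
    remaining ones are then forced by [null_of_invariant]. *)
Lemma signed_design k : (k <= n)%N ->
  exists D : 'S_n -> rat, (forall x, D x \is a Num.int) /\
    null k (fun x => D x - (n ^_ k * (k`! * k`!))%:R / n`!%:R).
Proof.
move=> kn; pose Z : {set 'I_n} := [set widen_ord kn i | i in 'I_k].
have cZ : #|Z| = k.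
  by rewrite card_imset ?card_ord // => i j /(congr1 val) /= /val_inj.
(* The statistic of the constant 1 / (n - k)!. *)
pose v m : rat := ((n - #|m|) ^_ (k - #|m|))%:R.
have [|m _|w [wi wv]] := @prescribed_stats Z v k; first by rewrite cZ.
  exact: rpred_nat.
pose S := [set s : 'S_n | perm_on Z s].
have cS : #|S| = k`! by rewrite -cZ -card_perm; apply: eq_card => s; rewrite inE.
pose D x := \sum_(a in S) \sum_(b in S) w (a * x * b)%g.
exists D; split; first by move=> x; do 2!apply: rpred_sum => ? _.
apply: (@null_of_invariant _ _ Z).
- move=> z z' zZ z'Z x; congr (_ - _); rewrite /D.
  rewrite [RHS](reindex_inj (mulIg (tperm z z'))) /=; apply: eq_big => [a|a _].
    by rewrite !inE perm_on_tpermM.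
  by apply: eq_bigr => b _; rewrite !mulgA.
- move=> z z' zZ z'Z x; congr (_ - _); apply: eq_bigr => a _.
  rewrite [RHS](reindex_inj (mulgI (tperm z z'))) /=; apply: eq_big => [b|b _].
    by rewrite !inE perm_on_tpermM.
  by rewrite !mulgA.
move=> m mk m1 m2.
have [[x cx]|none] := altP (@existsP _ (contains m)); last first.
  by apply: big_pred0 => x; apply/negbTE; apply: contraNN none => cx; apply/existsP; exists x.
have av : avoids Z m by apply/forall_inP => p pm; rewrite m1 ?m2.
rewrite statB stat_sum (eq_bigr (fun _ => #|S|%:R * v m)) => [|a aS]; last first.
  rewrite stat_sum (eq_bigr (fun _ => v m)) ?sumr_const ?mulr_natl // => b bS.
  rewrite !inE in aS bS.
  by rewrite (stat_sandwich w aS bS av) (wv m x).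
rewrite sumr_const.
have stat_cst (K : rat) : stat m (fun _ => K) = K * stat m (fun _ => 1).
  by rewrite -statZ; apply: eq_stat => y; rewrite mulr1.
rewrite stat_cst (stat_one cx) cS -mulr_natl.
have e1 : (n ^_ k * (n - k)`! = n`!)%N by rewrite ffact_fact.
have e2 : ((n - #|m|) ^_ (k - #|m|) * (n - k)`! = (n - #|m|)`!)%N.
  rewrite -(@ffact_fact (n - #|m|) (k - #|m|)); last by rewrite leq_sub2r.
  by congr (_ * _`!)%N; lia.
rewrite -e1 -e2 /v !natrM.
have f0 : (n - k)`!%:R != 0 :> rat by rewrite pnatr_eq0 -lt0n fact_gt0.
have g0 : (n ^_ k)%:R != 0 :> rat by rewrite pnatr_eq0 -lt0n ffact_gt0.
by field; rewrite f0 g0.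
Qed.

End Triangular.

(** * Assembling the set *)

Lemma sum_ind n (P : {set 'S_n}) : \sum_x ind P x = #|P|%:R.
Proof.
rewrite -sum1_card natr_sum [RHS]big_mkcond; apply: eq_bigr => x _.
by rewrite ffunE; case: (x \in P).
Qed.

Lemma toggle_generators n t M : let B := generators n t in
    (2 ^ t * (delta_cost n t * (2 * M * #|B|)) < (n - t.*2)`!)%N ->
  exists R G0 : {set 'S_n},
    [/\ G0 \subset R, (#|R| <= delta_cost n t * (2 * M * #|B|))%N &
      forall E : 'S_n -> rat, (forall y, y \notin B -> E y = 0) ->
        (forall y, E y \is a Num.int) -> (forall y, `|E y| <= M%:R) ->
      exists2 G : {set 'S_n}, G \subset R &
        null t (fun y => ind G y - (ind G0 y + M%:R * ind B y + E y))].
Proof.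
move=> B lt.
(* M toggles to add each generator and M to remove it, the base holding M copies. *)
pose xs := flatten [seq nseq (2 * M) b | b <- enum B].
have sz : size xs = (2 * M * #|B|)%N.
  rewrite size_flatten /shape -map_comp cardE.
  by elim: (enum B) => [|b s IH] /=; rewrite ?muln0 // IH size_nseq mulnS.
have cnt b : b \in B -> (2 * M <= count_mem b xs)%N.
  rewrite -mem_enum /xs; elim: (enum B) => //= a s IH; rewrite inE count_cat.
  case/orP=> [/eqP ->|/IH]; last by move/leq_trans; apply; apply: leq_addl.
  by rewrite count_nseq /= eqxx mul1n leq_addr.
have [|R [G0 [sG0 cR hR]]] := @toggle_set n t xs; first by rewrite sz.
exists R, G0; split=> //; first by rewrite -sz.
move=> E E0 Ei EM.
pose nu b := if b \in B then Num.truncn (M%:R + E b) else 0%N.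
have ME b : 0 <= M%:R + E b by have := EM b; rewrite ler_norml => /andP[]; lra.
have nuE b : (nu b)%:R = M%:R * ind B b + E b :> rat.
  rewrite /nu ffunE; case: (boolP (b \in B)) => [bB|/E0 ->]; last by rewrite mulr0 addr0.
  rewrite mulr1; apply/truncnK; rewrite natrEint ME rpredD // rpred_nat //.
have [b|G sG nG] := hR nu.
  have [bB|bB] := boolP (b \in B); last by rewrite /nu (negbTE bB).
  apply: leq_trans (cnt b bB); rewrite -(ler_nat rat) nuE ffunE bB mulr1.
  by have := EM b; rewrite ler_norml natrM => /andP[]; lra.
by exists G => //; apply: eq_null nG => y; rewrite nuE; lra.
Qed.

(** Start from the uniform weight X / n!, spread the part of it that lies on R, and
    subtract a spread copy of g. Each of the two corrections is at most a quarter of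
    X / n! at each permutation, so the result stays between 0 and 1. *)
Lemma near_uniform n k r X (R : {set 'S_n}) (g : 'S_n -> rat) (mg : nat) :
    (0 < r)%N -> (2 ^ k * (#|R| + delta_cost n k * r) < (n - k.*2)`!)%N ->
    (4 * #|R| <= r)%N -> (forall x, 0 <= g x) -> \sum_x g x <= mg%:R ->
    (4 * mg * n`! <= X * r)%N -> (2 * X <= n`!)%N ->
  exists eta : 'S_n -> rat, [/\ forall x, 0 <= eta x <= 1,
    forall x, x \in R -> eta x = 0 &
    null k (fun x => X%:R / n`!%:R - g x - eta x)].
Proof.
move=> r0 lt Rr g0 gm Xr Xn; have [s hs] := spread r0 lt.
have s0 x y : y \in R -> s x y = 0 by have [h _ _] := hs x; apply: h.
have sr x y : `|s x y| <= r%:R^-1 by have [_ h _] := hs x; apply: h.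
have sn x : null k (fun y => delta x y - s x y) by have [] := hs x.
pose K : rat := X%:R / n`!%:R.
have fn : 0 < n`!%:R :> rat by rewrite ltr0n fact_gt0.
have rn : 0 < r%:R :> rat by rewrite ltr0n.
have K0 : 0 <= K by rewrite divr_ge0.
have K2 : K <= 2^-1.
  by rewrite ler_pdivrMr // ler_pdivlMl // -natrM ler_nat.
pose u y := \sum_(x in R) s x y; pose v y := \sum_x g x * s x y.
exists (fun y => K * (1 - ind R y) + K * u y - v y).
have ub y : `|u y| <= 4^-1.
  apply: le_trans (ler_norm_sum _ _ _) _.
  apply: (@le_trans _ _ (\sum_(x in R) r%:R^-1)); first by apply: ler_sum.
  rewrite sumr_const -[_ *+ #|R|]mulr_natl ler_pdivrMr // ler_pdivlMl // -natrM ler_nat //.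
have vb y : `|v y| <= K / 4.
  apply: le_trans (ler_norm_sum _ _ _) _.
  apply: (@le_trans _ _ (\sum_x g x * r%:R^-1)).
    by apply: ler_sum => x _; rewrite normrM ger0_norm // ler_wpM2l.
  rewrite -mulr_suml ler_pdivrMr // /K.
  have -> : X%:R / n`!%:R / 4 * r%:R = X%:R * r%:R / (4 * n`!%:R) :> rat.
    by field; rewrite gt_eqF.
  apply: le_trans gm _; rewrite ler_pdivlMr ?mulr_gt0 //.
  move: Xr; rewrite -(ler_nat rat) !natrM => Xr; lra.
split.
- move=> y; rewrite ffunE; case: (boolP (y \in R)) => yR.
    rewrite subrr mulr0 add0r /u /v !big1 ?mulr0 ?subr0 ?lexx ?ler01 // => x _;
      by rewrite s0 ?mulr0.
  have ub' : `|K * u y| <= K / 4 by rewrite normrM ger0_norm ?ler_wpM2l.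
  have := ub'; have := vb y; rewrite !ler_norml => /andP[v1 v2] /andP[u1 u2].
  by apply/andP; split; rewrite subr0 mulr1; lra.
- move=> y yR; rewrite ffunE yR subrr mulr0 add0r /u /v !big1 ?mulr0 ?subr0 // => x _;
    by rewrite s0 ?mulr0.
apply: (@eq_null _ _ (fun y => K * (\sum_(x in R) (delta x y - s x y))
   - \sum_x g x * (delta x y - s x y))) => [y|].
  have e1 : \sum_(x in R) delta x y = ind R y.
    rewrite big_mkcond ffunE (bigD1 y) //= big1 ?addr0 => [|x /negbTE ne].
      by rewrite ffunE eqxx; case: (y \in R).
    by rewrite ffunE eq_sym ne; case: (_ \in _).
  have e2 : \sum_x g x * delta x y = g y.
    rewrite (bigD1 y) //= big1 ?addr0 => [|x /negbTE ne]; rewrite ffunE ?eqxx ?mulr1 //.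
    by rewrite eq_sym ne mulr0.
  under [X in _ - X]eq_bigr => x _ do rewrite mulrBr.
  rewrite !sumrB e1 e2 -/(u y) -/(v y) -/K; ring.
apply: nullB; first by apply: nullZ; apply: null_sum.
by apply: null_sum => x _; apply: nullZ.
Qed.

(** M bounds the coefficients of the correction E, rho the size of the reserved
    region R, mg the mass of g; none of them depends on L or r. *)
Lemma uniform_set n t r L : let k := t.*2 in let B := generators n t in
    let M := ((n * n).+1 ^ k * delta_cost n t + #|B| * (2 ^ t.+1 * delta_cost n t))%N in
    let rho := (delta_cost n t * (2 * M * #|B|))%N in
    let mg := (rho + M * #|B|)%N in
    let X := (L * (n ^_ k * (k`! * k`!)))%N in
    (k <= n)%N -> (0 < r)%N ->
    (2 ^ t * rho < (n - t.*2)`!)%N ->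
    (2 ^ k * (rho + delta_cost n k * r) < (n - k.*2)`!)%N -> (4 * rho <= r)%N ->
    (4 * mg * n`! <= X * r)%N -> (2 * X <= n`!)%N ->
  exists T : {set 'S_n}, null t (fun x => ind T x - X%:R / n`!%:R).
Proof.
move=> k B M rho mg X kn r0 c1 c2 c3 c4 c5.
have [R [G0 [sG0 cR hR]]] := @toggle_generators n t M c1.
pose g y := ind G0 y + M%:R * ind B y.
have gi x : g x \is a Num.int by rewrite /g !ffunE rpredD ?rpredM // rpred_nat.
have g0 x : 0 <= g x by rewrite /g !ffunE addr_ge0 // mulr_ge0.
have gm : \sum_x g x <= mg%:R.
  rewrite big_split -mulr_sumr /= !sum_ind /mg natrD [(M * _)%:R]natrM lerD2r.
  by rewrite ler_nat (leq_trans (subset_leq_card sG0)).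
have [||eta [eta01 etaR neta]] := @near_uniform n k r X R g mg r0 _ _ g0 gm c4 c5.
- by apply: leq_ltn_trans c2; rewrite leq_mul2l leq_add2r cR orbT.
- by apply: leq_trans c3; rewrite leq_mul2l cR.
have [F [c [Feta cm nF]]] := round_to_set k eta01.
have [D0 [D0i nD0]] := signed_design kn.
(* What the indicator of F and g lack to be uniform; congruent to c. *)
pose D x := L%:R * D0 x - g x - ind F x.
have nX : null k (fun x => L%:R * D0 x - X%:R / n`!%:R).
  by apply: eq_null (nullZ L%:R nD0) => x; rewrite mulrBr mulrA -natrM.
have Di x : D x \is a Num.int by rewrite !rpredB ?rpredM ?rpred_nat // ffunE rpred_nat.
have nDc : null t.*2 (fun x => D x - c x).
  by apply: eq_null (nullD nX (nullD neta nF)) => x; rewrite /D; lra.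
have [E [E0 Ei EM nE]] := integral_correction Di nDc.
have [||y|G sG nG] := hR E; rewrite //.
  apply: le_trans (EM y) _; rewrite /M natrD lerD2r natrM.
  by rewrite ler_wpM2r.
exists (G :|: F); rewrite indU; last first.
  apply: disjI => x /(subsetP sG)/etaR e xF.
  by have := Feta x e; rewrite xF.
have nX' := nullW (leq_trans (leq_addr t t) (eq_leq (addnn t))) nX.
apply: eq_null (nullD nG (nullB nX' nE)) => x; rewrite !ffunE /D /g !ffunE; lra.
Qed.

Lemma perm_extending n t (i j : 'I_t -> 'I_n) : injective i -> injective j ->
  exists x : 'S_n, forall k, x (i k) = j k.
Proof.
move=> ii ij.
suff [x h] : exists x : 'S_n, forall k, k \in enum 'I_t -> x (i k) = j k.
  by exists x => k; apply: h; rewrite mem_enum.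
elim: (enum 'I_t) => [|k s [x h]]; first by exists 1%g.
exists (x * tperm (x (i k)) (j k))%g => l; rewrite inE permM.
have [->|lk /= ls] := eqVneq l k; first by rewrite tpermL.
have xk : x (i k) != x (i l) by apply: contra lk => /eqP e; rewrite (ii _ _ (perm_inj e)).
have jk : j k != x (i l) by rewrite h //; apply: contra lk => /eqP/ij ->.
by rewrite tpermD // h.
Qed.

Lemma null_twise n t X (T : {set 'S_n}) : (t <= n)%N ->
  null t (fun x => ind T x - X%:R / n`!%:R) -> twise_permutation t T /\ #|T| = X.
Proof.
move=> tn nT.
have f0 : n`!%:R != 0 :> rat by rewrite pnatr_eq0 -lt0n fact_gt0.
have count m (x : 'S_n) : contains m x -> (#|m| <= t)%N ->
    #|[set p in T | contains m p]|%:R = X%:R / n`!%:R * (n - #|m|)`!%:R :> rat.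
  move=> cx mt; rewrite -(stat_one cx) -statZ.
  have := nT m mt; rewrite statB => /subr0_eq e.
  rewrite -[RHS](_ : stat m (ind T) = _); last first.
    by rewrite e; apply: eq_stat => y; rewrite mulr1.
  rewrite -sum1_card natr_sum /stat [RHS]big_mkcond [LHS]big_mkcond; apply: eq_bigr => y _.
  by rewrite ffunE inE; case: (y \in T); case: (contains m y).
have cT : #|T| = X.
  have h : contains set0 (1%g : 'S_n) by apply/containsP => i j; rewrite inE.
  have := count set0 _ h; rewrite cards0 subn0 divfK // => /(_ isT) /eqP.
  rewrite eqr_nat => /eqP <-; apply: eq_card => y; rewrite inE.
  by case: containsP => [_|[]]; rewrite ?andbT // => i j; rewrite inE.
split=> // i j ii ij; have [x hx] := perm_extending ii ij.
pose m := [set (i k, j k) | k in 'I_t].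
have cm (y : 'S_n) : contains m y = [forall k, y (i k) == j k].
  apply/containsP/forallP => [h k|h a b /imsetP[k _ [-> ->]]]; last exact/eqP.
  by rewrite (h (i k) (j k)) //; apply/imsetP; exists k.
have card_m : #|m| = t by rewrite card_imset ?card_ord // => a b [/ii].
have cx : contains m x by rewrite cm; apply/forallP => k; rewrite hx.
have := count m x cx; rewrite card_m leqnn => /(_ isT) e.
have -> : [set p in T | [forall k, p (i k) == j k]] = [set p in T | contains m p].
  by apply/setP => y; rewrite !inE cm.
rewrite e cT -(ffact_fact tn) natrM.
have g0 : (n - t)`!%:R != 0 :> rat by rewrite pnatr_eq0 -lt0n fact_gt0.
have h0 : (n ^_ t)%:R != 0 :> rat by rewrite pnatr_eq0 -lt0n ffact_gt0.
by field; rewrite g0 h0.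
Qed.

(** * Numerical bounds *)

Section Powers.
Variable a : nat.
Hypothesis a2 : (2 <= a)%N.

Lemma le_powW i j x : (i <= j)%N -> (x <= a ^ i)%N -> (x <= a ^ j)%N.
Proof. by move=> ij h; apply: leq_trans h _; rewrite leq_pexp2l // ltnW. Qed.

Lemma le_powM i j x y : (x <= a ^ i)%N -> (y <= a ^ j)%N -> (x * y <= a ^ (i + j))%N.
Proof. by move=> h1 h2; rewrite expnD leq_mul. Qed.

Lemma le_powD i x y : (x <= a ^ i)%N -> (y <= a ^ i)%N -> (x + y <= a ^ i.+1)%N.
Proof.
move=> h1 h2; rewrite expnS; apply: leq_trans (leq_add h1 h2) _.
by rewrite addnn -mul2n leq_mul2r a2 orbT.
Qed.
End Powers.

Lemma expn_le_fact h j : (h ^ j <= (h + j)`!)%N.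
Proof.
elim: j => [|j IH]; first by rewrite addn0 fact_gt0.
by rewrite expnS addnS factS leq_mul // leqW // leq_addr.
Qed.

Lemma ffact_le_exp n k : (n ^_ k <= n ^ k)%N.
Proof. by elim: k => // k IH; rewrite ffactnSr expnSr leq_mul // leq_subr. Qed.

Lemma fact_le_exp k : (k`! <= k ^ k)%N.
Proof. by rewrite -ffactnn ffact_le_exp. Qed.

Lemma fact_large n t : (1000 * t < n)%N -> (0 < t)%N -> ((n ^ t) ^ 60 <= (n - 4 * t)`!)%N.
Proof.
move=> nt t0; pose p := (n %/ 4)%N.
have p1 : (p + p <= n - 4 * t)%N by rewrite /p; lia.
have p2 : (n <= p ^ 2)%N.
  have : (n < 4 * p.+1)%N by rewrite /p; lia.
  have : (250 <= p)%N by rewrite /p; lia.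
  rewrite -mulnn; nia.
apply: leq_trans (leq_fact p1); apply: leq_trans (expn_le_fact p p).
rewrite -expnM; apply: (@leq_trans ((p ^ 2) ^ (t * 60))).
  by rewrite leq_exp2r //; lia.
rewrite -expnM leq_pexp2l //; rewrite /p; lia.
Qed.

(** With a = n^t all quantities of [uniform_set] are small powers of a, while
    (n - 4t)! is at least a^60; so L = a^44 and r = (n - 4t)! / a^12 satisfy the
    hypotheses. *)
Lemma exists_design n t : (1000 * t < n)%N -> (0 < t)%N ->
  exists T : {set 'S_n}, exists2 X : nat, (0 < X <= (n ^ t) ^ 50)%N &
    null t (fun x => ind T x - X%:R / n`!%:R).
Proof.
move=> nt t0; have [a ea] : exists a, a = (n ^ t)%N by exists (n ^ t)%N.
rewrite -ea.
have n0 : (0 < n)%N by lia.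
have na : (n <= a)%N by rewrite ea -{1}[n]expn1 leq_pexp2l.
have a2 : (2 <= a)%N by apply: leq_trans na; lia.
have a0 : (0 < a)%N by apply: leq_trans a2.
pose k := t.*2.
have kn : (k <= n)%N by rewrite /k; lia.
have kkn : (k.*2 <= n)%N by rewrite /k; lia.
have k4 : (k.*2 = 4 * t)%N by rewrite /k; lia.
have pW := @le_powW a a2; have pM := @le_powM a; have pD := @le_powD a a2.
have n1 : (n <= a ^ 1)%N by rewrite expn1.
have two : (2 <= a ^ 1)%N by rewrite expn1.
have k0 : (0 < k)%N by rewrite double_gt0.
have n2 : (2 <= n)%N by lia.
have twot : (2 ^ t <= a ^ 1)%N by rewrite expn1 ea leq_exp2r.
have nk : (n ^ k = a ^ 2)%N by rewrite ea -expnM muln2.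
have nka : (n ^ k <= a ^ 2)%N by rewrite nk.
have twok : (2 ^ k <= a ^ 2)%N by apply: leq_trans nka; rewrite leq_exp2r.
have t1 : (t.+1 <= a ^ 1)%N by apply: leq_trans twot; apply: ltn_expl.
have k1 : (k.+1 <= a ^ 2)%N by apply: leq_trans twok; apply: ltn_expl.
have A4 : (delta_cost n t <= a ^ 4)%N.
  apply: leq_trans (cost_le _ _ n0) _; rewrite expnS.
  have nta : (n ^ t <= a ^ 1)%N by rewrite expn1 ea.
  exact: (pM _ _ _ _ (pM _ _ _ _ t1 twot) (pM _ _ _ _ n1 nta)).
have A7 : (delta_cost n k <= a ^ 7)%N.
  apply: leq_trans (cost_le _ _ n0) _; rewrite expnS.
  exact: (pM _ _ _ _ (pM _ _ _ _ k1 twok) (pM _ _ _ _ n1 nka)).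
have B6 : (#|generators n t| <= a ^ 6)%N.
  apply: leq_trans (card_generators t n0) _.
  have n4 : (n ^ (4 * t) <= a ^ 4)%N by rewrite mulnC expnM ea.
  exact: (pM _ _ _ _ (pM _ _ _ _ twot n4) t1).
have d6 : ((n * n).+1 ^ k <= a ^ 6)%N.
  have -> : (a ^ 6 = (n ^ 3) ^ k)%N by rewrite ea -!expnM; congr (_ ^ _)%N; rewrite /k; lia.
  rewrite leq_exp2r // !expnS expn0; nia.
pose M := ((n * n).+1 ^ k * delta_cost n t + #|generators n t| * (2 ^ t.+1 * delta_cost n t))%N.
have M13 : (M <= a ^ 13)%N.
  apply: pD; first by apply: (pW 10%N) => //; exact: (pM _ _ _ _ d6 A4).
  rewrite expnS; exact: (pM _ _ _ _ B6 (pM _ _ _ _ (pM _ _ _ _ two twot) A4)).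
pose rho := (delta_cost n t * (2 * M * #|generators n t|))%N.
have rho24 : (rho <= a ^ 24)%N.
  exact: (pM _ _ _ _ A4 (pM _ _ _ _ (pM _ _ _ _ two M13) B6)).
pose mg := (rho + M * #|generators n t|)%N.
have mg25 : (mg <= a ^ 25)%N.
  by apply: pD => //; apply: (pW 19%N) => //; exact: (pM _ _ _ _ M13 B6).
pose x0 := (n ^_ k * (k`! * k`!))%N.
have x06 : (x0 <= a ^ 6)%N.
  have kf : (k`! <= a ^ 2)%N.
    apply: leq_trans (fact_le_exp k) _; by apply: leq_trans nka; rewrite leq_exp2r.
  have nf : (n ^_ k <= a ^ 2)%N by apply: leq_trans nka; apply: ffact_le_exp.
  exact: (pM _ _ _ _ nf (pM _ _ _ _ kf kf)).
have x00 : (0 < x0)%N by rewrite !muln_gt0 ffact_gt0 kn fact_gt0.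
pose N1 := (n - k.*2)`!.
have N60 : (a ^ 60 <= N1)%N.
  have e : (4 * t = k.*2)%N by rewrite /k; lia.
  by have := fact_large nt t0; rewrite e ea.
pose r := (N1 %/ a ^ 12)%N.
have rN : (a ^ 12 * r <= N1)%N by rewrite mulnC leq_trunc_div.
have r26 : (a ^ 26 <= r)%N.
  rewrite leq_divRL ?expn_gt0 ?a0 // -expnD; apply: leq_trans N60; rewrite leq_pexp2l //.
have rN2 : (N1 <= 2 * a ^ 12 * r)%N.
  have := ltn_ceil N1 (_ : 0 < a ^ 12)%N; rewrite expn_gt0 a0 -/r => /(_ isT) /ltnW h.
  have r1 : (0 < r)%N by apply: leq_trans r26; rewrite expn_gt0 a0.
  apply: leq_trans h _; rewrite mulnAC leq_mul2r; apply/orP; right.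
  by rewrite mul2n -addnn -add1n leq_add2r.
have r0 : (0 < r)%N by apply: leq_trans r26; rewrite expn_gt0 a0.
have four : (4 <= a ^ 2)%N by rewrite -[4%N]/(2 ^ 2)%N leq_exp2r.
have nfact : (n`! <= a ^ 4 * N1)%N.
  rewrite -(@ffact_fact n k.*2) //.
  rewrite leq_mul2r; apply/orP; right; apply: leq_trans (ffact_le_exp _ _) _.
  by rewrite ea -expnM k4 leq_pexp2l // mulnC.
have X50 : (a ^ 44 * x0 <= a ^ 50)%N by apply: (pM 44%N 6%N).
have N1n : (N1 <= n`!)%N by rewrite leq_fact // leq_subr.
have [|||||T hT] := @uniform_set n t r (a ^ 44) kn r0.
- apply: (@leq_ltn_trans (a ^ 25)); first exact: (pM _ _ _ _ twot rho24).
  apply: (@leq_trans (a ^ 60)); first by rewrite ltn_exp2l.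
  by apply: leq_trans N60 _; apply: leq_fact; rewrite leq_sub2l // /k -!addnn leq_addr.
- rewrite -/N1 mulnDr.
  have h1 : (2 ^ k * rho <= a ^ 26)%N by exact: (pM _ _ _ _ twok rho24).
  have h2 : (2 ^ k * (delta_cost n k * r) <= a ^ 9 * r)%N.
    by rewrite mulnA leq_mul2r; apply/orP; right; exact: (pM _ _ _ _ twok A7).
  have h3 : (a ^ 9 * r + a ^ 26 < a ^ 12 * r)%N.
    have a3 : (8 <= a ^ 3)%N by rewrite -[8%N]/(2 ^ 3)%N leq_exp2r.
    have h8 : (8 * (a ^ 9 * r) <= a ^ 12 * r)%N.
      by rewrite mulnA leq_mul2r -[12%N]/(3 + 9)%N expnD leq_mul2r a3 !orbT.
    have u0 : (0 < a ^ 9 * r)%N by rewrite muln_gt0 expn_gt0 a0.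
    have hu : (a ^ 26 <= a ^ 9 * r)%N.
      by apply: leq_trans r26 _; rewrite leq_pmull // expn_gt0 a0.
    apply: leq_trans h8; apply: (@leq_ltn_trans (2 * (a ^ 9 * r))%N).
      by rewrite mul2n -addnn leq_add2l.
    by rewrite ltn_mul2r u0.
  apply: leq_trans rN; apply: leq_ltn_trans h3; rewrite addnC; exact: leq_add.
- by apply: leq_trans r26; apply: (pM 2%N 24%N).
- apply: (@leq_trans (a ^ 44 * r)%N); last first.
    by rewrite leq_mul2r leq_pmulr ?orbT.
  have h27 : (4 * mg <= a ^ 27)%N by exact: (pM _ _ _ _ four mg25).
  apply: (@leq_trans (a ^ 27 * (a ^ 4 * (2 * a ^ 12 * r)))%N).
    by apply: leq_mul => //; apply: leq_trans nfact _; rewrite leq_mul2l rN2 orbT.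
  have -> : (a ^ 27 * (a ^ 4 * (2 * a ^ 12 * r)) = 2 * (a ^ 27 * a ^ 4 * a ^ 12) * r)%N.
    by ring.
  by rewrite -!expnD leq_mul2r; apply/orP; right; apply: (pM 1%N 43%N).
- apply: leq_trans N1n; apply: leq_trans N60; apply: (pW 51%N) => //.
  exact: (pM 1%N 50%N).
exists T, (a ^ 44 * x0)%N => //; rewrite X50 andbT muln_gt0 expn_gt0 a0 //.
Qed.

Theorem theorem1p6 (R : realType) :
  exists c : R, 0 < c /\
    forall n t : nat, (1 <= n)%N -> (1 <= t <= n)%N ->
      exists T : {set 'S_n},
        [/\ T != set0,
            twise_permutation t T
          & #|T|%:R <= (c * n%:R) `^ (c * t%:R)].
Proof.
exists 1000%:R; split; first by rewrite ltr0n.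
move=> n t n1 /andP[t0 tn].
suff [T [X [X0 Xle nT]]] : exists (T : {set 'S_n}) (X : nat),
    [/\ (0 < X)%N, (X <= (1000 * n) ^ (1000 * t))%N &
        null t (fun x => ind T x - X%:R / n`!%:R)].
  have [tw cT] := null_twise tn nT; exists T; split=> //.
    by rewrite -card_gt0 cT.
  by rewrite -!natrM powR_mulrn ?ler0n // -natrX ler_nat cT.
have [le|lt] := leqP n (1000 * t).
  exists [set: 'S_n], n`!; split; first exact: fact_gt0.
    apply: leq_trans (fact_le_exp n) _.
    apply: (@leq_trans ((1000 * n) ^ n)); first by rewrite leq_exp2r // leq_pmull.
    by rewrite leq_pexp2l // muln_gt0.
  apply: eq_null (@null0 _ _) => x; rewrite ffunE inE divff ?subrr //.
  by rewrite pnatr_eq0 -lt0n fact_gt0.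
have [T [X /andP[X0 X50] nT]] := exists_design lt t0.
exists T, X; split=> //; apply: leq_trans X50 _.
rewrite -expnM; apply: (@leq_trans (n ^ (1000 * t))).
  by rewrite leq_pexp2l //; lia.
by rewrite leq_exp2r ?leq_pmull //; lia.
Qed.
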